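(* Let $(S,\mathcal{A},\mu)$ be a complete measure space, $E$ a Köthe function space over $(S,\mathcal{A},\mu)$ and $X$ a Banach space. If $\mu$ is a $\sigma$-finite measure and $E$ is $\mathrm{sluacs}^+$ and reflexive and both $E$ and $E^*$ have the Kadets-Klee property, then $E(X)$ is sluacs whenever $X$ is sluacs.
   Context: All Banach spaces are real. For a Banach space $X$, $X^*$ denotes its dual, $B_X$ its closed unit ball and $S_X$ its unit sphere. A Banach space $X$ is called: - sluacs (strongly locally uniformly alternatively convex or smooth) if for every $x\in S_X$ and all sequences $(x_n)$ in $S_X$ and $(x_n^* )$ in $S_{X^*}$: $\|x_n+x\|\to2$ and $x_n^*(x_n)\to1$ imply $x_n^*(x)\to1$; - $\mathrm{sluacs}^+$ if for every $x\in S_X$, every sequence $(x_n)$ in $S_X$ with $\|x_n+x\|\to2$ and all sequences $(x_n^* )$ in $S_{X^*}$: $x_n^*(x_n)\to1$ if and only if $x_n^*(x)\to1$. A Banach space $X$ has the Kadets-Klee property if for every sequence $(x_n)$ in $X$ and each $x\in X$: $x_n\to x$ weakly and $\|x_n\|\to\|x\|$ imply $\|x_n-x\|\to0$. A Köthe function space over a complete, $\sigma$-finite measure space $(S,\mathcal{A},\mu)$ is a Banach space $(E,\|\cdot\|_E)$ of real-valued measurable functions on $S$ modulo equality $\mu$-a.e. such that: (i) $\chi_A\in E$ for every $A\in\mathcal{A}$ with $\mu(A)<\infty$; (ii) every $f\in E$ is $\mu$-integrable over every $A\in\mathcal{A}$ with $\mu(A)<\infty$; (iii) if $g$ is measurable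 and $f\in E$ with $|g(t)|\le|f(t)|$ $\mu$-a.e., then $g\in E$ and $\|g\|_E\le\|f\|_E$. For a Köthe function space $E$ and a Banach space $X$, the Köthe-Bochner space $E(X)$ is the Banach space of all Bochner-measurable functions $f:S\to X$ (modulo equality a.e.) with $\|f(\cdot)\|\in E$, normed by $\|f\|_{E(X)}=\|\,\|f(\cdot)\|\,\|_E$; Bochner-measurable means being the $\mu$-a.e. norm limit of a sequence of simple functions. *)

(* Defs.v *)
From HB Require Import structures.
From mathcomp Require Import all_boot all_order all_algebra.
From mathcomp Require Import generic_quotient ring_quotient.
From mathcomp Require Import all_classical all_reals all_analysis.
From mathcomp Require Import measurable_realfun.

Set Implicit Arguments.
Unset Strict Implicit.
Unset Printing Implicit Defensive.

Import Order.TTheory GRing.Theory Num.Theory.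
Import numFieldNormedType.Exports.

Local Open Scope classical_set_scope.
Local Open Scope ring_scope.

Section dual_space.
Context (R : realType) (X : normedModType R).

Definition dual_pred : {pred X -> R^o} :=
  mem [set f : X -> R^o | linear f /\ continuous f].

Lemma dual_submod_closed : submod_closed dual_pred.
Proof.
split.
  apply/mem_set; split; last exact: cst_continuous.
  by move=> a x y; rewrite /= scaler0 addr0.
move=> a f g /set_mem[lf cf] /set_mem[lg cg]; apply/mem_set; split.
  move=> b x y.
  have E z : (a *: f + g) z = a *: f z + g z by [].
  rewrite !E lf lg !scalerDr !scalerA (mulrC b a) -!addrA; congr (_ + _).
  by rewrite addrCA.
by move=> x; apply: cvgD; [apply: cvgZl_tmp; exact: cf|exact: cg].
Qed.

HB.instance Definition _ :=
  GRing.isSubmodClosed.Build _ _ dual_pred dual_submod_closed.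

Record dual_space : Type := DualSpace {
  dual_val : X -> R^o ;
  _ : dual_val \in dual_pred }.

HB.instance Definition _ := [isSub for dual_val].
HB.instance Definition _ := [Choice of dual_space by <:].
HB.instance Definition _ := [SubChoice_isSubLmodule of dual_space by <:].

Definition dual_fun (f : dual_space) : X -> R := dual_val f.
Local Coercion dual_fun : dual_space >-> Funclass.

Lemma dual_linear (f : dual_space) : linear (f : X -> R^o).
Proof. by have /set_mem[] := valP f. Qed.

Lemma dual_continuous (f : dual_space) : continuous (f : X -> R).
Proof. by have /set_mem[] := valP f. Qed.

Lemma dual_funD (f g : dual_space) x : (f + g) x = f x + g x.
Proof. by []. Qed.

Lemma dual_funZ a (f : dual_space) x : (a *: f) x = a * f x.
Proof. by []. Qed.

Definition dual_norm (f : dual_space) : R :=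
  sup [set `|f x| | x in [set x : X | `|x| <= 1]].

Lemma dual_has_sup (f : dual_space) :
  has_sup [set `|f x| | x in [set x : X | `|x| <= 1]].
Proof.
split; first by exists `|f 0|, 0 => //=; rewrite normr0.
pose F := GRing.isLinear.Build _ _ _ _ (f : X -> R^o) (@dual_linear f).
pose g : {linear X -> R^o} := HB.pack (f : X -> R^o) F.
have := (linear_bounded_continuous g).2 (@dual_continuous f).
move=> /(bounded_funP g).2 /(_ 1)[M fM].
by exists M => _ [x /= x1 <-]; exact: fM.
Qed.

Lemma dual_norm_ub (f : dual_space) (x : X) :
  `|x| <= 1 -> `|f x| <= dual_norm f.
Proof. by move=> x1; apply: (sup_upper_bound (dual_has_sup f)); exists x. Qed.

Lemma le_dual_norm (f : dual_space) (x : X) : `|f x| <= dual_norm f * `|x|.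
Proof.
have f0 : f 0 = 0.
  by have := dual_linear f (-1) 0 0; rewrite scaler0 addr0 scaleN1r addNr.
have [->|x0] := eqVneq x 0; first by rewrite f0 !normr0 mulr0.
have nx : 0 < `|x| by rewrite normr_gt0.
have : `|f (`|x|^-1 *: x)| <= dual_norm f.
  by apply: dual_norm_ub; rewrite normrZ normfV normr_id mulVf// gt_eqF.
have := dual_linear f `|x|^-1 x 0; rewrite !addr0 f0 addr0 => ->.
by rewrite normrM normfV normr_id ler_pdivrMl// mulrC.
Qed.

Lemma dual_norm_le (f : dual_space) (M : R) :
  (forall x, `|x| <= 1 -> `|f x| <= M) -> dual_norm f <= M.
Proof.
move=> fM; apply: ge_sup; first exact: (dual_has_sup f).1.
by move=> _ [x /= /fM ? <-].
Qed.

Lemma dual_normD f g : dual_norm (f + g) <= dual_norm f + dual_norm g.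
Proof.
apply: dual_norm_le => x x1; rewrite dual_funD (le_trans (ler_normD _ _))//.
by rewrite lerD// dual_norm_ub.
Qed.

Lemma dual_norm_ge0 f : 0 <= dual_norm f.
Proof.
by apply: (@le_trans _ _ `|f 0|) => //; apply: dual_norm_ub; rewrite normr0.
Qed.

Lemma dual_normZ a f : dual_norm (a *: f) = `|a| * dual_norm f.
Proof.
have le b g : dual_norm (b *: g) <= `|b| * dual_norm g.
  apply: dual_norm_le => x x1; rewrite dual_funZ normrM ler_wpM2l//.
  by rewrite (le_trans (le_dual_norm _ _))// ler_piMr// dual_norm_ge0.
apply/eqP; rewrite eq_le le/=.
have [->|a0] := eqVneq a 0; first by rewrite normr0 mul0r dual_norm_ge0.
have := le a^-1 (a *: f); rewrite scalerA mulVf// scale1r normfV.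
by rewrite ler_pdivlMl// normr_gt0.
Qed.

Lemma dual_norm_eq0 f : dual_norm f = 0 -> f = 0.
Proof.
move=> f0; apply/val_inj/funext => x; apply/eqP; rewrite -normr_le0.
by have := le_dual_norm f x; rewrite f0 mul0r.
Qed.

HB.instance Definition _ :=
  Lmodule_isNormed.Build R dual_space dual_normD dual_normZ dual_norm_eq0.

End dual_space.
Coercion dual_fun : dual_space >-> Funclass.

Section banach_properties.
Context (R : realType).
Implicit Type X : normedModType R.

(* strongly locally uniformly alternatively convex or smooth *)
Definition sluacs X :=
  forall (x : X) (x_ : nat -> X) (f_ : nat -> dual_space X),
    `|x| = 1 -> (forall n, `|x_ n| = 1) -> (forall n, `|f_ n| = 1) ->
    `|x_ n + x| @[n --> \oo] --> (2 : R) ->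
    f_ n (x_ n) @[n --> \oo] --> (1 : R) ->
    f_ n x @[n --> \oo] --> (1 : R).

Definition sluacs_plus X :=
  forall (x : X) (x_ : nat -> X) (f_ : nat -> dual_space X),
    `|x| = 1 -> (forall n, `|x_ n| = 1) -> (forall n, `|f_ n| = 1) ->
    `|x_ n + x| @[n --> \oo] --> (2 : R) ->
    (f_ n (x_ n) @[n --> \oo] --> (1 : R) <->
     f_ n x @[n --> \oo] --> (1 : R)).

Definition weakly_cvg X (x_ : nat -> X) (x : X) :=
  forall f : dual_space X, f (x_ n) @[n --> \oo] --> f x.

Definition kadets_klee X :=
  forall (x_ : nat -> X) (x : X), weakly_cvg x_ x ->
    `|x_ n| @[n --> \oo] --> `|x| ->
    `|x_ n - x| @[n --> \oo] --> (0 : R).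

(* surjectivity of the canonical embedding of X into its bidual *)
Definition reflexive_space X :=
  forall phi : dual_space (dual_space X),
    exists x : X, forall f : dual_space X, phi f = f x.

End banach_properties.

(* The elements of a Koethe function space are classes of measurable functions
   modulo mu-a.e. equality: the Banach space kothe_space comes with its
   (linear and injective) inclusion into the classes of measurable functions.
   A class coerces to one of its representatives. *)
Record kothe_function_space d (T : measurableType d) (R : realType)
    (mu : {measure set T -> \bar R}) := KotheFunctionSpace {
  kothe_space :> completeNormedModType R ;
  kothe_class : kothe_space -> {mfun_ mu, T >-> measurableTypeR R} ;
  kothe_linear : forall (a : R) (f g : kothe_space),
    \forall t \ae mu,
      kothe_class (a *: f + g) t = a * kothe_class f t + kothe_class g t ;
  kothe_inj : injective kothe_class ;
  kothe_indic : forall A : set T, measurable A -> (mu A < +oo)%E ->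
    exists f : kothe_space, \forall t \ae mu, kothe_class f t = \1_A t ;
  kothe_integrable : forall (f : kothe_space) (A : set T),
    measurable A -> (mu A < +oo)%E ->
    mu.-integrable A (fun t => (kothe_class f t)%:E) ;
  kothe_ideal : forall (g : T -> R) (f : kothe_space),
    measurable_fun setT g ->
    (\forall t \ae mu, `|g t| <= `|kothe_class f t|) ->
    exists h : kothe_space,
      (\forall t \ae mu, kothe_class h t = g t) /\ `|h| <= `|f| }.

Section bochner_measurable.
Context d (T : measurableType d) (R : realType) (mu : {measure set T -> \bar R}).
Context (X : normedModType R).

(* No finiteness of the measure of the support is imposed: for sigma-finite mu
   it would not change the class of Bochner-measurable functions. *)
Definition simple_function (s : T -> X) :=
  finite_set (range s) /\ forall x, measurable (s @^-1` [set x]).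

Definition bochner_measurable (f : T -> X) :=
  exists s : nat -> T -> X, (forall n, simple_function (s n)) /\
    \forall t \ae mu, s n t @[n --> \oo] --> f t.

Lemma simple_function_preimage (s : T -> X) (A : set X) :
  simple_function s -> measurable (s @^-1` A).
Proof.
move=> [fs ms].
have -> : s @^-1` A = \bigcup_(x in range s `&` A) s @^-1` [set x].
  apply/seteqP; split => [t At|t [x [_ Ax] /= ->]] //.
  by exists (s t) => //; split => //; exists t.
apply: fin_bigcup_measurable => //; first exact: finite_setIl.
Qed.

Lemma simple_function_comp2 (s u : T -> X) (op : X -> X -> X) :
  simple_function s -> simple_function u ->
  simple_function (fun t => op (s t) (u t)).
Proof.
move=> ss su; split.
  apply: (@sub_finite_set _ _ [set op x y | x in range s & y in range u]).
    by move=> _ [t _ <-]; exists (s t); [exists t|exists (u t) => //; exists t].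
  by apply: finite_image2; [case: ss|case: su].
move=> x.
have -> : (fun t => op (s t) (u t)) @^-1` [set x] = \bigcup_(y in range s)
    (s @^-1` [set y] `&` u @^-1` [set z | op y z = x]).
  apply/seteqP; split => [t /= At|t [y _ [/= <-]]] //.
  by exists (s t); [exists t|split].
apply: fin_bigcup_measurable; first by case: ss.
by move=> y _; apply: measurableI; exact: simple_function_preimage.
Qed.

Lemma simple_function_cst (x : X) : simple_function (fun=> x).
Proof.
split; first by apply: (sub_finite_set _ (finite_set1 x)) => _ [t _ <-].
by move=> y; rewrite preimage_cst; case: ifP.
Qed.

Lemma bochner_measurable_cst (x : X) : bochner_measurable (fun=> x).
Proof.
exists (fun _ _ => x); split; first by move=> n; exact: simple_function_cst.
by apply: aeW => t; exact: cvg_cst.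
Qed.

Lemma bochner_measurable_linear (a : R) (f g : T -> X) :
  bochner_measurable f -> bochner_measurable g ->
  bochner_measurable (fun t => a *: f t + g t).
Proof.
move=> [s [ss sf]] [u [su ug]]; exists (fun n t => a *: s n t + u n t); split.
  move=> n; exact: (@simple_function_comp2 (s n) (u n) (fun x y => a *: x + y)).
apply: filterS2 sf ug => t sft ugt.
by apply: cvgD => //; apply: cvgZl_tmp.
Qed.

Lemma bochner_measurable_norm (f : T -> X) : bochner_measurable f ->
  exists h : T -> R, measurable_fun setT h /\ \forall t \ae mu, `|f t| = h t.
Proof.
move=> [s [ss sf]].
have ms n : measurable_fun setT (EFin \o (fun t => `|s n t|)).
  apply/measurable_EFinP => _ A mA; rewrite setTI.
  exact: (@simple_function_preimage (s n) [set x | A `|x|]).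
exists (fun t => fine (limn_esup (fun n => (`|s n t|)%:E))); split.
  apply: (measurableT_comp (fine_measurable (@measurableT _ (\bar R)))).
  exact: measurable_fun_limn_esup.
apply: filterS sf => t sft.
have /cvg_esups /cvg_lim lE : (`|s n t|)%:E @[n --> \oo] --> (`|f t|)%:E.
  by apply/cvg_EFin; [exact: nearW|exact: cvg_norm].
by rewrite limn_esup_lim lE.
Qed.

End bochner_measurable.

Section kothe_bochner.
Context d (T : measurableType d) (R : realType) (mu : {measure set T -> \bar R}).
Context (E : kothe_function_space mu) (X : normedModType R).

(* e is the class of t |-> ||f t||; by kothe_class_eq there is at most one
   such e, so `|e| is the norm of t |-> ||f t|| in E *)
Definition norm_class (f : T -> X) (e : E) :=
  \forall t \ae mu, kothe_class e t = `|f t|.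

Definition kothe_bochner_pred : {pred T -> X} :=
  mem [set f : T -> X | bochner_measurable mu f /\ exists e, norm_class f e].

Lemma kothe_class_eq (e1 e2 : E) :
  (\forall t \ae mu, kothe_class e1 t = kothe_class e2 t) -> e1 = e2.
Proof.
move=> e12; apply: kothe_inj.
rewrite -[LHS]reprK -[RHS]reprK; apply/eqmodP/asboolP.
by apply: filterS e12 => t et _.
Qed.

Lemma norm_class_linear (a : R) (f g : T -> X) (ef eg : E) :
  bochner_measurable mu f -> bochner_measurable mu g ->
  norm_class f ef -> norm_class g eg ->
  exists2 e : E, norm_class (fun t => a *: f t + g t) e &
    `|e| <= `|a| * `|ef| + `|eg|.
Proof.
move=> bf bg nf ng.
have [h [mh fh]] := bochner_measurable_norm (bochner_measurable_linear a bf bg).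
have [|e [eh le_e]] := @kothe_ideal _ _ _ _ E h (`|a| *: ef + eg) mh.
  apply: filterS3 (filterI nf ng) fh (kothe_linear `|a| ef eg) => t [nft ngt] <- ->.
  rewrite nft ngt normr_id (le_trans (ler_normD _ _))// normrZ.
  by rewrite ler_norm.
exists e; first by apply: filterS2 fh eh => t -> ->.
by rewrite (le_trans le_e)// (le_trans (ler_normD _ _))// normrZ normr_id.
Qed.

Lemma kothe_class0 : \forall t \ae mu, kothe_class (0 : E) t = 0.
Proof.
apply: filterS (kothe_linear (-1) (0 : E) 0) => t.
by rewrite scaler0 addr0 mulN1r addNr.
Qed.

Lemma kothe_bochner_submod_closed : submod_closed kothe_bochner_pred.
Proof.
split.
  apply/mem_set; split; first exact: bochner_measurable_cst.
  by exists 0; apply: filterS kothe_class0 => t ->; rewrite normr0.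
move=> a f g /set_mem[bf [ef nf]] /set_mem[bg [eg ng]]; apply/mem_set.
split; first exact: bochner_measurable_linear.
by have [e ne _] := norm_class_linear a bf bg nf ng; exists e.
Qed.

HB.instance Definition _ :=
  GRing.isSubmodClosed.Build _ _ kothe_bochner_pred kothe_bochner_submod_closed.

Record kothe_bochner_fun : Type := KotheBochnerFun {
  kothe_bochner_val :> T -> X ;
  _ : kothe_bochner_val \in kothe_bochner_pred }.

HB.instance Definition _ := [isSub for kothe_bochner_val].
HB.instance Definition _ := [Choice of kothe_bochner_fun by <:].
HB.instance Definition _ := [SubChoice_isSubLmodule of kothe_bochner_fun by <:].

Definition kothe_bochner_null : {pred kothe_bochner_fun} :=
  mem [set f : kothe_bochner_fun | \forall t \ae mu, f t = 0].

Lemma kothe_bochner_null_closed : zmod_closed kothe_bochner_null.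
Proof.
split; first by apply/mem_set; exact: aeW.
move=> f g /set_mem f0 /set_mem g0; apply/mem_set.
by apply: filterS2 f0 g0 => t ft gt; have : f t - g t = 0 by rewrite ft gt subr0.
Qed.

HB.instance Definition _ :=
  GRing.isZmodClosed.Build _ kothe_bochner_null kothe_bochner_null_closed.

(* equality in the quotient is equality mu-a.e., see kothe_bochner_eqP *)
Definition kothe_bochner : Type := Quotient.quot kothe_bochner_null.
HB.instance Definition _ := GRing.Zmodule.on kothe_bochner.


Local Open Scope quotient_scope.

Definition kothe_bochner_class (f : kothe_bochner_fun) : kothe_bochner :=
  \pi_(Quotient.quot kothe_bochner_null) f.

Lemma kothe_bochner_eqP (f g : kothe_bochner_fun) :
  kothe_bochner_class f = kothe_bochner_class g <-> \forall t \ae mu, f t = g t.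
Proof.
have E0 : kothe_bochner_class f = kothe_bochner_class g <->
    f - g \in kothe_bochner_null.
  by rewrite Quotient.idealrBE; split => [/eqP|/eqP].
rewrite E0; split.
  move/set_mem; apply: filterS => t /eqP.
  by rewrite -[_ == _]/(f t - g t == 0) subr_eq0 => /eqP.
move=> fg; apply/mem_set; apply: filterS fg => t ft.
by have : f t - g t = 0 by rewrite ft subrr.
Qed.

Lemma kothe_bochner_class_repr (u : kothe_bochner) :
  kothe_bochner_class (repr u) = u.
Proof. exact: reprK. Qed.

Lemma kothe_bochnerW (P : kothe_bochner -> Prop) :
  (forall f, P (kothe_bochner_class f)) -> forall u, P u.
Proof. by move=> Pf u; rewrite -(kothe_bochner_class_repr u). Qed.

Lemma kothe_bochner_classD (f g : kothe_bochner_fun) :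
  kothe_bochner_class (f + g) = kothe_bochner_class f + kothe_bochner_class g.
Proof. exact: pi_addr. Qed.

Lemma kothe_bochner_class0 : kothe_bochner_class 0 = 0.
Proof. exact: pi_zeror. Qed.

Lemma repr_class_ae (f : kothe_bochner_fun) :
  \forall t \ae mu, repr (kothe_bochner_class f) t = f t.
Proof. by apply/kothe_bochner_eqP; exact: kothe_bochner_class_repr. Qed.

Definition kothe_bochner_scale (a : R) (u : kothe_bochner) : kothe_bochner :=
  kothe_bochner_class (a *: (repr u : kothe_bochner_fun)).

Lemma kothe_bochner_scale_class a (f : kothe_bochner_fun) :
  kothe_bochner_scale a (kothe_bochner_class f) = kothe_bochner_class (a *: f).
Proof.
apply/kothe_bochner_eqP; apply: filterS (repr_class_ae f) => t ft.
by have : a *: repr (kothe_bochner_class f) t = a *: f t by rewrite ft.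
Qed.

Lemma kothe_bochner_scaleA a b u :
  kothe_bochner_scale a (kothe_bochner_scale b u) =
  kothe_bochner_scale (a * b) u.
Proof.
elim/kothe_bochnerW: u => f.
by rewrite (kothe_bochner_scale_class b f) !kothe_bochner_scale_class scalerA.
Qed.

Lemma kothe_bochner_scale1 : left_id 1 kothe_bochner_scale.
Proof. by elim/kothe_bochnerW => f; rewrite kothe_bochner_scale_class scale1r. Qed.

Lemma kothe_bochner_scaleDr : right_distributive kothe_bochner_scale +%R.
Proof.
move=> a; elim/kothe_bochnerW => f; elim/kothe_bochnerW => g.
by rewrite -kothe_bochner_classD !kothe_bochner_scale_class scalerDr kothe_bochner_classD.
Qed.

Lemma kothe_bochner_scaleDl u :
  {morph kothe_bochner_scale^~ u : a b / a + b}.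
Proof.
by elim/kothe_bochnerW: u => f a b; rewrite !kothe_bochner_scale_class scalerDl kothe_bochner_classD.
Qed.

HB.instance Definition _ := GRing.Zmodule_isLmodule.Build R kothe_bochner
  kothe_bochner_scaleA kothe_bochner_scale1 kothe_bochner_scaleDr
  kothe_bochner_scaleDl.

Lemma kothe_bochner_fun_norm_class (f : kothe_bochner_fun) :
  exists e, norm_class f e.
Proof. by have /set_mem[] := valP f. Qed.

Lemma kothe_bochner_fun_measurable (f : kothe_bochner_fun) :
  bochner_measurable mu f.
Proof. by have /set_mem[] := valP f. Qed.

Definition kothe_bochner_norm (u : kothe_bochner) : R :=
  `|sval (cid (kothe_bochner_fun_norm_class (repr u)))|.

Lemma kothe_bochner_norm_classE (f : kothe_bochner_fun) (e : E) :
  norm_class f e -> kothe_bochner_norm (kothe_bochner_class f) = `|e|.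
Proof.
rewrite /kothe_bochner_norm; case: cid => /= e' ne' ne.
congr `|_|; apply: kothe_class_eq.
by apply: filterS3 ne ne' (repr_class_ae f) => t -> -> ->.
Qed.

Lemma kothe_bochner_normD u v :
  kothe_bochner_norm (u + v) <= kothe_bochner_norm u + kothe_bochner_norm v.
Proof.
elim/kothe_bochnerW: u => f; elim/kothe_bochnerW: v => g; rewrite -kothe_bochner_classD.
have [ef nf] := kothe_bochner_fun_norm_class f.
have [eg ng] := kothe_bochner_fun_norm_class g.
have [e ne le_e] := norm_class_linear 1 (kothe_bochner_fun_measurable f)
  (kothe_bochner_fun_measurable g) nf ng.
rewrite (kothe_bochner_norm_classE nf) (kothe_bochner_norm_classE ng).
rewrite (@kothe_bochner_norm_classE (f + g) e); last first.
  by apply: filterS ne => t ->; rewrite scale1r.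
by rewrite normr1 mul1r in le_e.
Qed.

Lemma kothe_bochner_normZ a u :
  kothe_bochner_norm (a *: u) = `|a| * kothe_bochner_norm u.
Proof.
elim/kothe_bochnerW: u => f; rewrite [_ *: _]kothe_bochner_scale_class.
have [e ne] := kothe_bochner_fun_norm_class f.
rewrite (kothe_bochner_norm_classE ne) -[`|a|]normr_id -normrZ.
apply: kothe_bochner_norm_classE.
apply: filterS3 ne (kothe_linear `|a| e 0) kothe_class0 => t net.
by rewrite addr0 => -> ->; rewrite net addr0 [RHS]normrZ.
Qed.

Lemma kothe_bochner_norm_eq0 u : kothe_bochner_norm u = 0 -> u = 0.
Proof.
elim/kothe_bochnerW: u => f; have [e ne] := kothe_bochner_fun_norm_class f.
rewrite (kothe_bochner_norm_classE ne) => /normr0_eq0 e0.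
rewrite -kothe_bochner_class0; apply/kothe_bochner_eqP; rewrite {e}e0 in ne.
by apply: filterS2 ne kothe_class0 => t -> /normr0_eq0.
Qed.

HB.instance Definition _ := Lmodule_isNormed.Build R kothe_bochner
  kothe_bochner_normD kothe_bochner_normZ kothe_bochner_norm_eq0.

End kothe_bochner.

(* Main.v *)
From HB Require Import structures.
Require Import Defs.
From mathcomp Require Import all_boot all_order all_algebra.
From mathcomp Require Import all_classical all_reals all_analysis.
From mathcomp Require Import measurable_realfun.
From mathcomp Require Import lra.

Set Implicit Arguments.
Unset Strict Implicit.
Unset Printing Implicit Defensive.

Import Order.TTheory GRing.Theory Num.Theory.
Import numFieldNormedType.Exports.

Local Open Scope classical_set_scope.
Local Open Scope ring_scope.

(** Why the theorem holds. Let [f], [f_ n] be of norm one in [E(X)] with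
    [|f_ n + f|] tending to 2, and let [F_ n] be norm-one functionals with
    [F_ n (f_ n)] tending to 1; write [e], [e_ n], [psi_ n] for the elements
    [|f(.)|], [|f_ n(.)|], [|f_ n(.) + f(.)|] of [E]. The functionals [F_ n] are
    never represented by vector-valued functions. They are tested on
    [f_ n - tau_ n f] for scalars [tau_ n] tending to 0 more slowly than
    [1 - F_ n (f_ n)]: up to an error that is small compared with [tau_ n],
    [1 - tau_ n F_ n(f)] is at most the norm in [E] of [|f_ n(.) - tau_ n f(.)|],
    so that upper estimates of this norm give lower estimates of [F_ n(f)].

    Compactness. Since [E] is reflexive and both [E] and its dual have the
    Kadets-Klee property, a sequence [v_ n] with [|v_ n|] tending to 1 and
    [|v_ n + e|] to 2 has a norm-convergent subsequence
    ([kadets_klee_cvg_subseq]), and a further subsequence converges almost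
    everywhere ([kothe_cvg0_ae_subseq]). This applies to [e_ n], with limit [e0],
    and to [psi_ n / 2], with limit [p0]. As it suffices to find, in each
    subsequence, a further one along which [F_ n(f)] tends to 1, both sequences
    may be assumed to converge.

    Pointwise estimate. In a sluacs space, [(|y_ n - tau_ n x| - |y_ n|) / tau_ n]
    tends to [- |x|] as soon as [|y_ n + x|] tends to [lim |y_ n| + |x|] and
    [lim |y_ n| > 0] ([sluacs_directional]). At almost every point where
    [e0 > 0] and [2 p0 = e0 + e] it applies to [f_ n] and [f], so that
    [|f_ n - tau_ n f|] is there [e_ n - tau_ n e] up to [o(tau_ n)]; dominated
    convergence in [E] ([kothe_dominated_cvg], a consequence of reflexivity and the
    Kadets-Klee property) makes the error small in norm. On the sets
    [A = {e0 = 0}] and [B = {2 p0 < e0 + e}] only the bound [e_ n + tau_ n e] is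
    available. Hence the norm is at most [|e_ n + tau_ n c| + o(tau_ n)], where [c]
    is [- e] outside [A] and [B], and at least [e] on them.

    The exceptional sets are negligible. Let [phi_ n] be a functional norming
    [e_ n + tau_ n c]. It tends to 1 at [e_ n], hence at [e0]; as [E] is sluacs,
    also at [e], and then at [p0]. The same property for its restriction to the
    complement of [A] shows that it tends to 0 at [e] restricted to [A]
    ([cvg0_restrict_zero_set]). It tends to 0 at [e0 + e - 2 p0], which is positive
    on [B], and it is almost positive on the interval from 0 to [e0 + e] because it
    almost attains its norm there; so it tends to 0 at [e] restricted to [B]
    ([cvg0_restrict_pos_set]). Therefore [- phi_ n c] tends to 1, and so does
    [F_ n(f)]. *)

(** * The Hahn-Banach theorem *)

Section hahn_banach.
Context (R : realType) (V : lmodType R).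
Implicit Types (p q : V -> R).

Definition sublinear p :=
  (forall x y, p (x + y) <= p x + p y) /\
  (forall a x, 0 <= a -> p (a *: x) <= a * p x).

Lemma sublinear0 p : sublinear p -> p 0 = 0.
Proof.
move=> [pD pZ]; apply/eqP; rewrite eq_le; apply/andP; split.
  by have := pZ 0 0 (lexx _); rewrite scale0r mul0r.
by have := pD 0 0; rewrite addr0; lra.
Qed.

Lemma sublinear_ge p x : sublinear p -> - p (- x) <= p x.
Proof. by move=> sp; have := sp.1 x (- x); rewrite subrr sublinear0//; lra. Qed.

Lemma sublinearZ p a x : sublinear p -> 0 <= a -> p (a *: x) = a * p x.
Proof.
move=> sp; rewrite le_eqVlt => /predU1P[<-|a0].
  by rewrite scale0r mul0r sublinear0.
apply/eqP; rewrite eq_le; apply/andP; split; first exact/sp.2/ltW.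
have := sp.2 a^-1 (a *: x); rewrite invr_ge0 ltW// => /(_ isT).
by rewrite scalerA mulVf ?gt_eqF// scale1r ler_pdivlMl.
Qed.

(** The largest sublinear functional below [p] whose value at [- y] is at most
    [- p y]; it equals [p] exactly when [p] is additive in the direction [y]. *)
Definition directional p y x : R :=
  inf [set p (x + t *: y) - t * p y | t in [set t | 0 <= t]].

Lemma directional_has_inf p y x : sublinear p ->
  has_inf [set p (x + t *: y) - t * p y | t in [set t | 0 <= t]].
Proof.
move=> sp; split; first by exists (p (x + 0 *: y) - 0 * p y), 0 => /=.
exists (- p (- x)) => _ [t /= t0 <-].
have := sp.1 (x + t *: y) (- x); rewrite addrAC subrr add0r sublinearZ//; lra.
Qed.

Lemma directional_le p y x t : sublinear p -> 0 <= t ->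
  directional p y x <= p (x + t *: y) - t * p y.
Proof. by move=> sp t0; apply: (ge_inf (directional_has_inf y x sp).2); exists t. Qed.

Lemma directional_ge p y x m : sublinear p ->
  (forall t, 0 <= t -> m <= p (x + t *: y) - t * p y) -> m <= directional p y x.
Proof.
move=> sp mp; apply: lb_le_inf; first exact: (directional_has_inf y x sp).1.
by move=> _ [t /= t0 <-]; exact: mp.
Qed.

Lemma directional_le_self p y x : sublinear p -> directional p y x <= p x.
Proof.
move=> sp; apply: le_trans (directional_le y x sp (lexx 0)) _.
by rewrite scale0r addr0 mul0r subr0.
Qed.

Lemma directional_sublinear p y : sublinear p -> sublinear (directional p y).
Proof.
move=> sp; split=> [x1 x2|a x a0].
  rewrite -lerBlDr; apply: directional_ge => // t t0.
  rewrite lerBlDr -lerBlDl; apply: directional_ge => // s s0.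
  have ts0 : 0 <= t + s by rewrite addr_ge0.
  have := directional_le y (x1 + x2) sp ts0.
  have := sp.1 (x1 + t *: y) (x2 + s *: y).
  by rewrite addrACA -scalerDl; lra.
move: a0; rewrite le_eqVlt => /predU1P[<-|a0].
  by rewrite scale0r mul0r (le_trans (directional_le_self _ _ _))// sublinear0.
rewrite -ler_pdivrMl//; apply: directional_ge => // t t0.
rewrite ler_pdivrMl//; have at0 : 0 <= a * t by rewrite mulr_ge0// ltW.
apply: le_trans (directional_le y (a *: x) sp at0) _.
by rewrite -scalerA -scalerDr (sublinearZ _ sp (ltW a0)) mulrBr mulrA.
Qed.

Lemma minimal_sublinear p : sublinear p ->
  exists q, [/\ sublinear q, forall x, q x <= p x &
    forall r, sublinear r -> (forall x, r x <= q x) -> r = q].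
Proof.
move=> sp.
pose P q := sublinear q /\ forall x, q x <= p x.
pose T := {q : V -> R | P q}.
pose below (s t : T) := `[< forall x, sval t x <= sval s x >].
have [||||q qmin] := @Zorn T below.
- by move=> t; apply/asboolP => x.
- move=> r s t /asboolP rs /asboolP st; apply/asboolP => x.
  exact: le_trans (st x) (rs x).
- move=> [s hs] [t ht] /asboolP /= st /asboolP /= ts; apply: eq_exist.
  by apply/funext => x; apply/eqP; rewrite eq_le st ts.
- move=> A totA; have [->|/set0P[q0 Aq0]] := eqVneq A set0.
    by exists (exist P p (conj sp (fun x => lexx (p x)))).
  pose vals x := [set sval q x | q in A].
  have vinf x : has_inf (vals x).
    split; first by exists (sval q0 x), q0.
    exists (- p (- x)) => _ [q Aq <-]; have [sq qp] := svalP q.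
    by have := sublinear_ge x sq; have := qp (- x); lra.
  have infle (q : T) x : A q -> inf (vals x) <= sval q x.
    by move=> Aq; apply: (ge_inf (vinf x).2); exists q.
  have leinf x m : (forall q : T, A q -> m <= sval q x) -> m <= inf (vals x).
    move=> h; apply: lb_le_inf; first exact: (vinf x).1.
    by move=> _ [q Aq <-]; exact: h.
  have si : sublinear (fun x => inf (vals x)).
    split=> [x y|a x a0].
      rewrite -lerBlDr; apply: (leinf) => q Aq.
      rewrite lerBlDr -lerBlDl; apply: (leinf) => r Ar.
      (* [q] and [r] are comparable, and the smaller one serves for both terms *)
      have [/asboolP h|/asboolP h] := totA _ _ Aq Ar.
        have := infle r (x + y) Ar; have := (svalP r).1.1 x y; have := h x; lra.
      by have := infle q (x + y) Aq; have := (svalP q).1.1 x y; have := h y; lra.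
    move: a0; rewrite le_eqVlt => /predU1P[<-|a0].
      rewrite scale0r mul0r; apply: le_trans (infle q0 0 Aq0) _.
      by rewrite sublinear0//; exact: (svalP q0).1.
    rewrite -ler_pdivrMl//; apply: (leinf) => q Aq; rewrite ler_pdivrMl//.
    by apply: le_trans (infle q _ Aq) _; exact/(svalP q).1.2/ltW.
  have ip x : inf (vals x) <= p x.
    exact: le_trans (infle q0 x Aq0) ((svalP q0).2 x).
  exists (exist P _ (conj si ip)) => s As; apply/asboolP => x /=; exact: infle.
exists (sval q); split; [exact: (svalP q).1|exact: (svalP q).2|move=> r sr rq].
have rp x : r x <= p x by exact: le_trans (rq x) ((svalP q).2 x).
by rewrite -(qmin (exist P r (conj sr rp)))//; apply/asboolP.
Qed.

(** A minimal sublinear functional equals each of its directional variants,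
    hence is additive. Starting from [directional p x0] instead of [p] forces
    the value at [x0]. *)
Theorem hahn_banach p (x0 : V) : sublinear p ->
  exists f : V -> R, [/\ linear (f : V -> R^o), forall x, f x <= p x & f x0 = p x0].
Proof.
move=> sp; have [q [sq qp qmin]] := minimal_sublinear (directional_sublinear x0 sp).
have qdir y : directional q y = q.
  by apply: qmin => [|x]; [exact: directional_sublinear|exact: directional_le_self].
have qD x y : q (x + y) = q x + q y.
  apply/eqP; rewrite eq_le sq.1/= -lerBrDr -{1}(qdir y).
  by have := directional_le y x sq ler01; rewrite scale1r mul1r.
have qN x : q (- x) = - q x.
  by apply/eqP; rewrite -addr_eq0 -qD addNr sublinear0.
have qle x : q x <= p x.
  by apply: le_trans (qp x) _; exact: directional_le_self.
exists q; split => //.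
  move=> a x y; rewrite qD; congr (_ + _).
  have [a0|/ltW a0] := leP 0 a; first by rewrite sublinearZ.
  have := @sublinearZ q (- a) x sq; rewrite oppr_ge0 => /(_ a0).
  by rewrite scaleNr qN mulNr => /oppr_inj.
apply/eqP; rewrite eq_le qle/=.
have := qp (- x0); have := directional_le x0 (- x0) sp ler01.
by rewrite qN scale1r mul1r addNr sublinear0//; lra.
Qed.

End hahn_banach.

(** * Subsequences and limits of sequences *)

Section subsequences.

Lemma increasing_seq_ge (s : nat -> nat) : increasing_seq s -> forall n, (n <= s n)%N.
Proof.
move=> /increasing_seqP s_incr; elim=> // n /leq_ltn_trans; apply.
by have := s_incr n; rewrite ltEnat.
Qed.

Lemma increasing_seq_cvg (s : nat -> nat) : increasing_seq s -> s n @[n --> \oo] --> \oo.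
Proof.
move=> /increasing_seq_ge sge A [N _ NA]; exists N => // n Nn; apply: NA => /=.
exact: leq_trans (sge n).
Qed.

Lemma cvg_subseq (V : topologicalType) (u : nat -> V) (s : nat -> nat) (l : V) :
  increasing_seq s -> u n @[n --> \oo] --> l -> u (s n) @[n --> \oo] --> l.
Proof. by move=> /increasing_seq_cvg sc; apply: cvg_comp. Qed.

Lemma increasing_seq_comp (s t : nat -> nat) :
  increasing_seq s -> increasing_seq t -> increasing_seq (fun n => s (t n)).
Proof. by move=> si ti n m; rewrite si -leEnat ti. Qed.

Lemma exists_increasing (P : nat -> nat -> Prop) :
  (forall k N, exists n, (N <= n)%N /\ P k n) ->
  exists s : nat -> nat, increasing_seq s /\ forall k, P k (s k).
Proof.
move=> exP; have [n0 [_ Pn0]] := exP 0%N 0%N.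
pose Q (a b : nat * nat) := [/\ b.1 = a.1.+1, (a.2 < b.2)%N & P b.1 b.2].
have [v [v0 vQ]] : {v : nat -> nat * nat | v 0%N = (0%N, n0) /\
    forall n, Q (v n) (v n.+1)}.
  apply: dependent_choice => -[k n].
  by have /cid[m [nm Pm]] := exP k.+1 n.+1; exists (k.+1, m).
have v1 n : (v n).1 = n by elim: n => [|n IH]; [rewrite v0|have [-> _ _] := vQ n; rewrite IH].
exists (fun n => (v n).2); split.
  by apply/increasing_seqP => n; have [] := vQ n.
by case=> [|k]; [rewrite v0|have [_ _] := vQ k; rewrite v1].
Qed.

Lemma cvg_of_subseq (R : realType) (u : nat -> R) (l : R) :
  (forall s, increasing_seq s ->
    exists t, increasing_seq t /\ u (s (t n)) @[n --> \oo] --> l) ->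
  u n @[n --> \oo] --> l.
Proof.
move=> sub; apply/cvgrPdist_lt => e e0; apply: contrapT => nu.
have [|s [si su]] := @exists_increasing (fun _ n => e <= `|l - u n|).
  move=> _ N; apply: contrapT => h; apply: nu; exists N => // n /= Nn.
  by rewrite ltNge; apply/negP => ?; apply: h; exists n.
have [t [ti /cvgrPdist_lt/(_ _ e0)[N _ /(_ N (leqnn N))/=]]] := sub _ si.
by rewrite ltNge su.
Qed.

Lemma squeeze_seq (R : realType) (f g h : nat -> R) (l : R) :
  (forall n, f n <= g n <= h n) ->
  f n @[n --> \oo] --> l -> h n @[n --> \oo] --> l -> g n @[n --> \oo] --> l.
Proof. by move=> fgh; apply: squeeze_cvgr; exact: nearW. Qed.

Lemma cvg_eq_seq (V : topologicalType) (u v : nat -> V) (l : V) :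
  (forall n, u n = v n) -> u n @[n --> \oo] --> l -> v n @[n --> \oo] --> l.
Proof. by move=> /funext ->. Qed.

Lemma cvg_of_dist (R : realType) (V : normedModType R) (x_ : nat -> V) (x : V) :
  `|x_ n - x| @[n --> \oo] --> (0 : R) -> x_ n @[n --> \oo] --> x.
Proof. by move=> xx; apply/subr_cvg0; exact: norm_cvg0. Qed.

Lemma cvg0_uniform_approx (R : realType) (r_ : nat -> R) :
  (forall e, 0 < e -> exists b_ : nat -> R, b_ n @[n --> \oo] --> (0 : R) /\
    forall n, `|r_ n| <= `|b_ n| + e) -> r_ n @[n --> \oo] --> (0 : R).
Proof.
move=> h; apply/cvgrPdist_lt => e e0.
have e20 : 0 < e / 2 by rewrite divr_gt0.
have [b [/cvgrPdist_lt/(_ _ e20)[N _ hN] rb]] := h _ e20.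
exists N => // n /= /hN; rewrite /= !sub0r !normrN; have := rb n; lra.
Qed.

End subsequences.

(** * Functionals on a normed space *)

Section dual_space_theory.
Context (R : realType).
Implicit Type X : normedModType R.

Lemma dualD X (f : dual_space X) x y : f (x + y) = f x + f y.
Proof. by have := dual_linear f 1 x y; rewrite !scale1r. Qed.

Lemma dual0 X (f : dual_space X) : f 0 = 0.
Proof. by have := dualD f 0 0; rewrite addr0; lra. Qed.

Lemma dualZ X (f : dual_space X) a x : f (a *: x) = a * f x.
Proof. by have := dual_linear f a x 0; rewrite !addr0 dual0 addr0. Qed.

Lemma dualN X (f : dual_space X) x : f (- x) = - f x.
Proof. by rewrite -scaleN1r dualZ mulN1r. Qed.

Lemma dualB X (f : dual_space X) x y : f (x - y) = f x - f y.
Proof. by rewrite dualD dualN. Qed.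

Lemma dual_funB X (f g : dual_space X) x : (f - g) x = f x - g x.
Proof. by []. Qed.

Lemma dual_ext X (f g : dual_space X) : (forall x, f x = g x) -> f = g.
Proof. by move=> fg; apply/val_inj/funext. Qed.

Lemma norm_dual_le X (f : dual_space X) x : `|f x| <= `|f| * `|x|.
Proof. exact: le_dual_norm. Qed.

Lemma dual_le X (f : dual_space X) x : f x <= `|f| * `|x|.
Proof. exact: le_trans (ler_norm _) (norm_dual_le _ _). Qed.

Lemma dual_norm_leM X (f : dual_space X) M : 0 <= M ->
  (forall x, f x <= M * `|x|) -> `|f| <= M.
Proof.
move=> M0 fM; apply: dual_norm_le => x x1; rewrite ler_norml.
have h y : `|y| <= 1 -> f y <= M by move=> y1; rewrite (le_trans (fM y))// ler_piMr.
by have := h _ x1; have := h (- x); rewrite normrN dualN => /(_ x1); lra.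
Qed.

Lemma exists_dual X (f : X -> R) M : linear (f : X -> R^o) ->
  (forall x, f x <= M * `|x|) -> exists F : dual_space X, forall x, F x = f x.
Proof.
move=> lf fM.
pose Fl := GRing.isLinear.Build _ _ _ _ (f : X -> R^o) lf.
pose g : {linear X -> R^o} := HB.pack (f : X -> R^o) Fl.
have gM x : `|g x| <= M * `|x|.
  have gN : f (- x) = - f x := linearN g x.
  by rewrite ler_norml -[g x]/(f x); have := fM x; have := fM (- x); rewrite normrN gN; lra.
have cf : continuous (f : X -> R^o).
  apply: (linear_bounded_continuous g).1; apply/(bounded_funP g) => r.
  exists (`|M| * r) => x xr; apply: le_trans (gM x) _.
  by apply: le_trans (ler_wpM2r (normr_ge0 _) (ler_norm M)) _; exact: ler_wpM2l.
by exists (DualSpace (mem_set (conj lf cf))).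
Qed.

Lemma exists_norming X (z x : X) : z != 0 ->
  exists f : dual_space X, `|f| = 1 /\ f x = `|x|.
Proof.
move=> z0.
have norming (y : X) : y != 0 -> exists f : dual_space X, `|f| = 1 /\ f y = `|y|.
  move=> y0; have sn : sublinear (fun u : X => `|u|).
    split; first exact: ler_normD.
    by move=> a u a0; rewrite normrZ ger0_norm.
  have [f [lf fle fy]] := hahn_banach y sn.
  have [|F Ff] := @exists_dual X f 1 lf; first by move=> u; rewrite mul1r.
  exists F; split; last by rewrite Ff.
  apply/eqP; rewrite eq_le dual_norm_leM//=; last by move=> u; rewrite mul1r Ff.
  by have := dual_le F y; rewrite Ff fy -ler_pdivrMr ?normr_gt0// divff ?normr_eq0.
have [->|/norming//] := eqVneq x 0.
by have [f [f1 _]] := norming _ z0; exists f; rewrite dual0 normr0.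
Qed.

Lemma dual_separates X (x : X) : (forall f : dual_space X, f x = 0) -> x = 0.
Proof.
move=> fx; apply/eqP/negPn/negP => x0; have [f [_]] := exists_norming x x0.
by rewrite fx => /esym/normr0_eq0 /eqP; rewrite (negbTE x0).
Qed.

(** A functional separating a point at positive distance is obtained below the
    distance to [Q], which is sublinear over the reals although [Q] is only
    stable under rational scalars. *)
Lemma dense_of_annihilator X (Q : set X) (x : X) :
  Q 0 -> (forall a b, Q a -> Q b -> Q (a + b)) ->
  (forall (r : rat) a, Q a -> Q (ratr r *: a)) ->
  (forall f : dual_space X, (forall q, Q q -> f q = 0) -> f x = 0) ->
  forall e, 0 < e -> exists2 q, Q q & `|x - q| < e.
Proof.
move=> Q0 QD QZ ann e e0.
pose p (y : X) : R := inf [set `|y - q| | q in Q].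
have pinf y : has_inf [set `|y - q| | q in Q].
  by split; [exists `|y - 0|, 0|exists 0 => _ [q _ <-]].
have ple y q : Q q -> p y <= `|y - q|.
  by move=> Qq; apply: (ge_inf (pinf y).2); exists q.
have lep y m : (forall q, Q q -> m <= `|y - q|) -> m <= p y.
  by move=> h; apply: lb_le_inf; [exact: (pinf y).1|move=> _ [q Qq <-]; exact: h].
have p_ge0 y : 0 <= p y by apply: lep.
have sp : sublinear p.
  split=> [y z|a y a0].
    rewrite -lerBlDr; apply: (lep) => q Qq; rewrite lerBlDr -lerBlDl.
    apply: (lep) => r Qr; rewrite lerBlDl.
    apply: le_trans (ple _ _ (QD _ _ Qq Qr)) _.
    by rewrite opprD addrACA ler_normD.
  move: a0; rewrite le_eqVlt => /predU1P[<-|a0].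
    by rewrite scale0r mul0r (le_trans (ple 0 0 Q0))// subr0 normr0.
  rewrite -ler_pdivrMl//; apply: (lep) => q Qq; rewrite ler_pdivrMl//.
  apply/ler_addgt0Pr => d d0.
  (* a rational scalar close to [a], at the scale of [q] *)
  have d'0 : 0 < d / (`|q| + 1) by rewrite divr_gt0// ltr_pwDr.
  have [r] : exists r, ratr r \in `]a, a + d / (`|q| + 1)[.
    by apply: rat_in_itvoo; rewrite ltrDl.
  rewrite in_itv/= => /andP[ar rd].
  apply: le_trans (ple _ _ (QZ r _ Qq)) _.
  have -> : a *: y - ratr r *: q = a *: (y - q) + (a - ratr r) *: q.
    by rewrite scalerBr scalerBl addrA subrK.
  apply: le_trans (ler_normD _ _) _.
  rewrite !normrZ (gtr0_norm a0) lerD2l ltr0_norm ?subr_lt0// opprB.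
  have rd' : ratr r - a <= d / (`|q| + 1) by rewrite lerBlDl ltW.
  apply: le_trans (ler_wpM2r (normr_ge0 q) rd') _.
  rewrite -mulrA; apply: ler_piMr; first exact: ltW.
  by rewrite ler_pdivrMl ?ltr_pwDr// mulr1 lerDl.
have pn y : p y <= `|y| by apply: le_trans (ple y 0 Q0) _; rewrite subr0.
have [f [lf fle fx]] := hahn_banach x sp.
have [|F Ff] := @exists_dual X f 1 lf.
  by move=> u; rewrite mul1r; exact: le_trans (fle u) (pn u).
have FQ q : Q q -> F q <= 0.
  by move=> Qq; rewrite Ff (le_trans (fle q))// (le_trans (ple _ _ Qq))// subrr normr0.
have /eqP : F x = 0.
  apply: ann => q Qq; apply/eqP; rewrite eq_le FQ//=.
  have := FQ _ (QZ (-1) _ Qq); rewrite rmorphN1 scaleN1r dualN; lra.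
rewrite Ff fx => /eqP px0.
apply: contrapT => h; have : e <= p x; last by rewrite px0 leNgt e0.
by apply: lep => q Qq; rewrite leNgt; apply/negP => ?; apply: h; exists q.
Qed.

(** A functional norming [x] is at most [|x_ n|] at [x_ n], and tends to [|x|]
    there. *)
Lemma weak_cvg_norm_le X (x_ : nat -> X) x r :
  weakly_cvg x_ x -> `|x_ n| @[n --> \oo] --> r -> `|x| <= r.
Proof.
move=> wx xr; have [->|x0] := eqVneq x 0.
  rewrite normr0 -(cvg_lim _ xr)//; apply: limr_ge; first by apply/cvg_ex; exists r.
  exact: nearW.
have [f [f1 fx]] := exists_norming x x0.
rewrite -fx; apply: ler_cvg_to (wx f) xr _; apply: nearW => n.
by have := dual_le f (x_ n); rewrite f1 mul1r.
Qed.

End dual_space_theory.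

(** * Weak sequential compactness of reflexive spaces *)

Section weak_compactness.
Context (R : realType).
Implicit Type X : normedModType R.

Lemma ultra_bounded_cvg (U : set_system nat) (u : nat -> R) (M : R) :
  UltraFilter U -> (forall n, `|u n| <= M) -> exists l : R, u n @[n --> U] --> l.
Proof.
move=> UU uM; have cM : compact `[- M, M]%classic := @segment_compact R (- M) M.
have [|p [_ clp]] := cM (u @ U) _.
  apply: (@filterE _ U _ (u @^-1` `[- M, M]%classic)) => n /=; rewrite in_itv/=.
  by have := uM n; rewrite ler_norml.
exists p => B Bp; have [//|nB] := in_ultra_setVsetC (u @^-1` B) UU.
by have [x []] := clp (~` B) B nB Bp.
Qed.

(** Reflexivity turns the bounded functional sending [f] to the limit of
    [f (x_ n)] along [U] into a point. *)
Lemma ultra_weak_limit X (U : set_system nat) (x_ : nat -> X) M :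
  reflexive_space X -> UltraFilter U -> (forall n, `|x_ n| <= M) ->
  exists x, forall f : dual_space X, f (x_ n) @[n --> U] --> f x.
Proof.
move=> Xrefl UU xM.
have fM (f : dual_space X) n : `|f (x_ n)| <= `|f| * M.
  by apply: le_trans (norm_dual_le _ _) _; exact: ler_wpM2l.
have /choice[L Llim] : forall f : dual_space X, exists l : R, f (x_ n) @[n --> U] --> l.
  by move=> f; apply: (ultra_bounded_cvg UU (fM f)).
have [||Phi PhiL] := @exists_dual R (dual_space X) L M.
- move=> a f g; apply: (cvg_unique _ (Llim (a *: f + g))) => //.
  by apply: cvgD (Llim g); apply: cvgZl_tmp; exact: Llim.
- move=> f; apply: ler_cvg_to (Llim f) (cvg_cst (M * `|f|)) _; apply: nearW => n.
  by rewrite mulrC; exact: le_trans (ler_norm _) (fM f n).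
have [x Px] := Xrefl Phi; exists x => f.
by rewrite -Px PhiL; exact: Llim.
Qed.

Lemma weak_cvg_of_ultra X (x_ : nat -> X) (x : X) M :
  reflexive_space X -> (forall n, `|x_ n| <= M) ->
  (forall U, UltraFilter U -> \oo `<=` U -> forall y,
    (forall f : dual_space X, f (x_ n) @[n --> U] --> f y) -> y = x) ->
  weakly_cvg x_ x.
Proof.
move=> Xrefl xM ux f; apply/cvgrPdist_lt => e e0; apply: contrapT => nf.
pose D := [set n | e <= `|f x - f (x_ n)|].
have PD : ProperFilter (within D \oo).
  apply: Build_ProperFilter_ex => B [N _ NB]; apply: contrapT => nB; apply: nf.
  exists N => // n /= Nn; rewrite ltNge; apply/negP => Dn; apply: nB.
  by exists n; apply: NB.
have [U [UU sU]] := ultraFilterLemma PD.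
have [y yU] := ultra_weak_limit Xrefl UU xM.
have UD : U D by apply: sU; exact: withinT.
have yx : y = x.
  apply: (ux U UU _ y yU) => B BN; apply: sU; exact: cvg_within BN.
have /cvgrPdist_lt/(_ _ e0) := yU f; rewrite yx => Ulim.
by have [n [/=]] := filter_ex (filterI UD Ulim); rewrite /D/= leNgt => /negP.
Qed.

(** A list of rational coefficients codes a finitely supported sequence: there
    are only countably many such combinations. *)
Definition rat_comb X (x_ : nat -> X) (s : seq rat) : X :=
  \sum_(i < size s) ratr s`_i *: x_ i.

Lemma rat_comb_widen X (x_ : nat -> X) (s : seq rat) n : (size s <= n)%N ->
  rat_comb x_ s = \sum_(i < n) ratr s`_i *: x_ i.
Proof.
move=> sn; rewrite /rat_comb (big_ord_widen _ (fun i => ratr s`_i *: x_ i) sn).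
rewrite [LHS]big_mkcond; apply: eq_bigr => i _; case: ifPn => //.
by rewrite -leqNgt => si; rewrite nth_default// rmorph0 scale0r.
Qed.

(** Let [x] be a weak limit of the sequence along an ultrafilter. A subsequence
    is chosen on which countably many functionals, norming the rational span of the sequence,
    converge to their value at [x]. Any other ultrafilter limit [y] of this
    subsequence has the same values; as [y - x] lies in the closed span, which
    the functionals norm, [y = x]. *)
Theorem reflexive_weakly_cvg_subseq X (x_ : nat -> X) M :
  reflexive_space X -> (forall n, `|x_ n| <= M) ->
  exists s x, increasing_seq s /\ weakly_cvg (fun n => x_ (s n)) x.
Proof.
move=> Xrefl xM.
have [[z z0]|X0] := pselect (exists z : X, z != 0); last first.
  exists id, 0; split => // f; have -> : (fun n => f (x_ (id n))) = (fun=> f 0).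
    apply/funext => n; congr (f _); apply/eqP/negPn/negP => xn0.
    by apply: X0; exists (x_ n).
  exact: cvg_cst.
have [U [UU sU]] := ultraFilterLemma (_ : ProperFilter \oo).
have [x xU] := ultra_weak_limit Xrefl UU xM.
pose q k := rat_comb x_ (odflt [::] (unpickle k)).
have /choice[psi psiq] : forall k, exists f : dual_space X, `|f| = 1 /\ f (q k) = `|q k|.
  by move=> k; exact: exists_norming z0.
pose P k n := forall j, (j <= k)%N -> `|psi j x - psi j (x_ n)| < k.+1%:R^-1.
have [|s [si sP]] := @exists_increasing P.
  move=> k N; have UN : U [set n | (N <= n)%N] by apply: sU; exists N.
  have UP m : U [set n | forall j, (j < m)%N -> `|psi j x - psi j (x_ n)| < k.+1%:R^-1].
    elim: m => [|m IH]; first by apply: filterE => n.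
    have k0 : 0 < k.+1%:R^-1 :> R by rewrite invr_gt0.
    have /cvgrPdist_lt/(_ _ k0) := xU (psi m); apply: filterS2 IH => n IH hm j.
    by rewrite ltnS leq_eqVlt => /predU1P[->|/IH].
  by have [n [Nn Pn]] := filter_ex (filterI UN (UP k.+1)); exists n; split.
have psix j : psi j (x_ (s n)) @[n --> \oo] --> psi j x.
  apply/cvgrPdist_lt => e e0; near=> n.
  apply: (@lt_trans _ _ n.+1%:R^-1); first by apply: (sP n); near: n; exists j.
  by near: n; exact: (near_infty_natSinv_lt (PosNum e0)).
exists s, x; split => //; apply: (weak_cvg_of_ultra Xrefl (fun n => xM (s n))).
move=> V VV sV y yV; apply/eqP; rewrite -subr_eq0 -normr_le0.
apply/ler_addgt0Pr => e e0; rewrite add0r.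
have e20 : 0 < e / 2 by rewrite divr_gt0.
have psi0 k : psi k (y - x) = 0.
  rewrite dualB; apply/eqP; rewrite subr_eq0; apply/eqP.
  apply: (cvg_unique _ (yV (psi k))) => //.
  by apply: cvg_trans (psix k) => B; exact: sV.
have [||||_ [t _ <-] qe] := @dense_of_annihilator R X (range (rat_comb x_)) (y - x) _ _ _ _ _ e20.
- by exists [::] => //; rewrite /rat_comb big_ord0.
- move=> _ _ [a _ <-] [b _ <-].
  exists (mkseq (fun i => a`_i + b`_i) (maxn (size a) (size b))) => //.
  rewrite /rat_comb size_mkseq -/(rat_comb x_ a) -/(rat_comb x_ b).
  rewrite (rat_comb_widen x_ (leq_maxl (size a) (size b))).
  rewrite (rat_comb_widen x_ (leq_maxr (size a) (size b))) -big_split/=.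
  by apply: eq_bigr => i _; rewrite nth_mkseq// rmorphD scalerDl.
- move=> r _ [a _ <-]; exists (map (fun c => r * c) a) => //.
  rewrite /rat_comb size_map scaler_sumr; apply: eq_bigr => i _.
  by rewrite (nth_map 0)// rmorphM scalerA.
- move=> f fQ; have fx n : f (x_ n) = 0.
    rewrite -(fQ (x_ n))//; exists (rcons (nseq n 0) 1) => //.
    rewrite /rat_comb size_rcons size_nseq big_ord_recr/= big1 => [|i _].
      by rewrite add0r nth_rcons size_nseq ltnn eqxx rmorph1 scale1r.
    by rewrite nth_rcons size_nseq ltn_ord nth_nseq ltn_ord rmorph0 scale0r.
  have lim0 (W : set_system nat) w (WP : ProperFilter W) (t : nat -> nat) :
      f (x_ (t n)) @[n --> W] --> f w -> f w = 0.
    move=> h; apply: (cvg_unique _ h) => //.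
    by rewrite (_ : (fun n => f (x_ (t n))) = fun=> 0); [exact: cvg_cst|apply/funext].
  by rewrite dualB (lim0 _ _ _ _ (yV f)) (lim0 _ _ _ _ (xU f)) subr0.
pose k := pickle t.
have qk : q k = rat_comb x_ t by rewrite /q /k pickleK.
have qk_lt : `|q k| < e / 2.
  have [p1 <-] := psiq k; apply: le_lt_trans qe.
  rewrite -[leLHS]subr0 -(psi0 k) -dualB; apply: le_trans (dual_le _ _) _.
  by rewrite p1 mul1r distrC qk.
have := ler_normD (y - x - q k) (q k); rewrite subrK.
by move: qe qk_lt; rewrite qk; lra.
Unshelve. all: by end_near. Qed.

Lemma exists_eval X (x : X) :
  exists J : dual_space (dual_space X), forall f : dual_space X, J f = f x.
Proof.
apply: (@exists_dual R (dual_space X) (fun f => f x) `|x|) => //.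
by move=> f; rewrite mulrC; exact: dual_le.
Qed.

Lemma dual_reflexive X : reflexive_space X -> reflexive_space (dual_space X).
Proof.
move=> Xrefl Phi; have [J JE] := choice (@exists_eval X).
have [||f fE] := @exists_dual R X (fun x => Phi (J x)) `|Phi|.
- move=> a x y; have -> : J (a *: x + y) = a *: J x + J y; last first.
    by rewrite dualD dualZ.
  apply: dual_ext => f; rewrite dual_funD dual_funZ !JE.
  by rewrite dualD dualZ.
- move=> x; apply: le_trans (dual_le _ _) _; apply: ler_wpM2l => //.
  by apply: dual_norm_leM => // f; rewrite JE mulrC dual_le.
exists f => phi; have [x xE] := Xrefl phi; rewrite xE fE; congr (Phi _).
by apply: dual_ext => g; rewrite xE JE.
Qed.

(** Norming functionals of [v_ n + e] tend to 1 at [e], so a weak limit of them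
    has norm one and, by the Kadets-Klee property of the dual, is a norm limit.
    It then takes the value 1 at a weak limit of the [v_ n], which is a norm
    limit for the same reason. *)
Theorem kadets_klee_cvg_subseq X (e : X) (v_ : nat -> X) :
  reflexive_space X -> kadets_klee X -> kadets_klee (dual_space X) ->
  `|e| = 1 -> `|v_ n| @[n --> \oo] --> (1 : R) ->
  `|v_ n + e| @[n --> \oo] --> (2 : R) ->
  exists s v, increasing_seq s /\ `|v_ (s n) - v| @[n --> \oo] --> (0 : R).
Proof.
move=> Xrefl XKK XdKK e1 v1 ve2.
have e0 : e != 0 by rewrite -normr_eq0 e1 oner_eq0.
have /choice[f fP] : forall n, exists f : dual_space X,
    `|f| = 1 /\ f (v_ n + e) = `|v_ n + e| by move=> n; exact: exists_norming e0.
have f1 n : `|f n| = 1 by have [] := fP n.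
have fve n : f n (v_ n) + f n e = `|v_ n + e| by have [_ <-] := fP n; rewrite dualD.
have fv n : f n (v_ n) <= `|v_ n| by have := dual_le (f n) (v_ n); rewrite f1 mul1r.
have fe n : f n e <= 1 by have := dual_le (f n) e; rewrite f1 mul1r e1.
have fe1 : f n e @[n --> \oo] --> (1 : R).
  apply: (@squeeze_seq _ (fun n => `|v_ n + e| - `|v_ n|) _ (fun=> 1)).
  - by move=> n; rewrite fe andbT -fve; have := fv n; lra.
  - by rewrite [X in _ --> X](_ : 1 = 2 - 1 :> R); [exact: cvgB|lra].
  - exact: cvg_cst.
have fv1 : f n (v_ n) @[n --> \oo] --> (1 : R).
  apply: (@cvg_eq_seq _ (fun n => `|v_ n + e| - f n e)).
    by move=> n; rewrite -fve addrK.
  by rewrite [X in _ --> X](_ : 1 = 2 - 1 :> R); [exact: cvgB|lra].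
have [|s [g [si wg]]] := @reflexive_weakly_cvg_subseq _ f 1 (dual_reflexive Xrefl).
  by move=> n; rewrite f1.
have ge1 : g e = 1.
  have [J JE] := exists_eval e; have := wg J; rewrite JE => Jlim.
  apply: (cvg_unique _ Jlim) => //; apply: cvg_eq_seq (cvg_subseq si fe1).
  by move=> n; rewrite JE.
have nf1 : `|f (s n)| @[n --> \oo] --> (1 : R).
  by apply: (@cvg_eq_seq R (fun=> 1)); [move=> n; rewrite f1|exact: cvg_cst].
have g1 : `|g| = 1.
  apply/eqP; rewrite eq_le (weak_cvg_norm_le wg nf1)/=.
  by have := dual_le g e; rewrite ge1 e1 mulr1.
have fg : `|f (s n) - g| @[n --> \oo] --> (0 : R) by apply: XdKK => //; rewrite g1.
have [M vM] : exists M, forall n, `|v_ n| <= M.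
  have /cvg_seq_bounded/bounded_fun_has_ubound[M hM] : cvgn (fun n => `|v_ n|).
    by apply/cvg_ex; exists 1.
  by exists M => n; apply: hM; exists n.
have [|t [v [ti wv]]] := @reflexive_weakly_cvg_subseq _ (fun n => v_ (s n)) M Xrefl.
  by move=> n; exact: vM.
have st : increasing_seq (fun n => s (t n)) := increasing_seq_comp si ti.
exists (fun n => s (t n)), v; split => //.
have gv1 : g v = 1.
  apply: (cvg_unique _ (wv g)) => //.
  have small : g (v_ (s (t n))) - f (s (t n)) (v_ (s (t n))) @[n --> \oo] --> (0 : R).
    apply: norm_cvg0; apply: (@squeeze_seq _ (fun=> 0) _
      (fun n => `|f (s (t n)) - g| * M)); last 2 first.
    - exact: cvg_cst.
    - rewrite -(mul0r M); apply: cvgM; last exact: cvg_cst.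
      exact: (cvg_subseq ti fg).
    move=> n; rewrite normr_ge0 /= distrC -dual_funB.
    apply: le_trans (norm_dual_le (f (s (t n)) - g) _) _; exact: ler_wpM2l.
  apply: (@cvg_eq_seq _ (fun n => g (v_ (s (t n))) - f (s (t n)) (v_ (s (t n)))
    + f (s (t n)) (v_ (s (t n))))) => [n|]; first by rewrite subrK.
  by rewrite -[X in _ --> X]add0r; apply: cvgD small (cvg_subseq st fv1).
have nv : `|v| = 1.
  apply/eqP; rewrite eq_le (weak_cvg_norm_le wv (cvg_subseq st v1))/=.
  by have := dual_le g v; rewrite gv1 g1 mul1r.
by apply: XKK => //; rewrite nv; exact: (cvg_subseq st v1).
Qed.

End weak_compactness.

(** * The lattice structure of a Koethe function space *)

Section kothe_lattice.
Context d (T : measurableType d) (R : realType) (mu : {measure set T -> \bar R}).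
Context (E : kothe_function_space mu).
Implicit Types (u v w : E) (A : set T).

Lemma measurable_kothe_class u : measurable_fun setT (kothe_class u : T -> R).
Proof. exact: (measurable_funPT (repr (kothe_class u))). Qed.

Lemma measurable_set_ltr (f g : T -> R) : measurable_fun setT f ->
  measurable_fun setT g -> measurable [set t | f t < g t].
Proof.
move=> mf mg; rewrite -[X in measurable X]setTI.
exact: (measurable_fun_ltr mf mg) measurableT [set true] _.
Qed.

Lemma kothe_classZ a u :
  \forall t \ae mu, kothe_class (a *: u) t = a * kothe_class u t.
Proof.
apply: filterS2 (kothe_linear a u 0) (kothe_class0 E) => t.
by rewrite addr0 => -> ->; rewrite addr0.
Qed.

Lemma kothe_classD u v :
  \forall t \ae mu, kothe_class (u + v) t = kothe_class u t + kothe_class v t.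
Proof. by apply: filterS (kothe_linear 1 u v) => t; rewrite scale1r mul1r. Qed.

Lemma kothe_classB u v :
  \forall t \ae mu, kothe_class (u - v) t = kothe_class u t - kothe_class v t.
Proof.
apply: filterS (kothe_linear (-1) v u) => t.
by rewrite scaleN1r addrC => ->; rewrite mulN1r addrC.
Qed.

Lemma exists_kothe (g : T -> R) u : measurable_fun setT g ->
  (\forall t \ae mu, `|g t| <= `|kothe_class u t|) ->
  exists v, \forall t \ae mu, kothe_class v t = g t.
Proof. by move=> mg /(kothe_ideal mg)[v [vg _]]; exists v. Qed.

Lemma kothe_norm_le u v :
  (\forall t \ae mu, `|kothe_class u t| <= `|kothe_class v t|) -> `|u| <= `|v|.
Proof.
move=> /(kothe_ideal (measurable_kothe_class u))[w [wu wv]].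
by rewrite -(kothe_class_eq wu).
Qed.

Lemma kothe_eq0 u : (\forall t \ae mu, kothe_class u t = 0) -> u = 0.
Proof.
by move=> u0; apply: kothe_class_eq; apply: filterS2 u0 (kothe_class0 E) => t -> ->.
Qed.

Lemma exists_kothe_restrict A u : measurable A -> exists v,
  \forall t \ae mu, kothe_class v t = if t \in A then kothe_class u t else 0.
Proof.
move=> mA; apply: (@exists_kothe _ u).
  rewrite (_ : (fun t => _) = (fun t => \1_A t * kothe_class u t)).
    by apply: measurable_funM; [exact: measurable_indic|exact: measurable_kothe_class].
  by apply/funext => t; rewrite indicE; case: (t \in A); rewrite (mul1r, mul0r).
by apply: aeW => t; case: ifP; rewrite ?normr0.
Qed.

(** Multiplication by the indicator of [A]; the default value 0 is taken only
    when no element of [E] represents the product. *)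
Definition kothe_restrict A u : E :=
  xget 0 [set v | \forall t \ae mu,
    kothe_class v t = if t \in A then kothe_class u t else 0].

Lemma kothe_restrictE A u : measurable A -> \forall t \ae mu,
  kothe_class (kothe_restrict A u) t = if t \in A then kothe_class u t else 0.
Proof.
move=> mA; have [v vE] := exists_kothe_restrict u mA.
exact: (@xgetPex _ 0 [set v | \forall t \ae mu,
  kothe_class v t = if t \in A then kothe_class u t else 0]) (ex_intro _ v vE).
Qed.

Lemma kothe_restrict_norm_le A u : measurable A -> `|kothe_restrict A u| <= `|u|.
Proof.
move=> mA; apply: kothe_norm_le; apply: filterS (kothe_restrictE u mA) => t ->.
by case: ifP => // _; rewrite normr0.
Qed.

Lemma exists_dual_restrict A (f : dual_space E) : measurable A ->
  exists g : dual_space E, `|g| <= `|f| /\ forall u, g u = f (kothe_restrict A u).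
Proof.
move=> mA; have fle u : f (kothe_restrict A u) <= `|f| * `|u|.
  apply: le_trans (dual_le _ _) _; apply: ler_wpM2l => //.
  exact: kothe_restrict_norm_le.
have [|g gE] := @exists_dual R E (fun u => f (kothe_restrict A u)) `|f| _ fle.
  move=> a u v; rewrite [RHS](_ : _ = f (a *: kothe_restrict A u + kothe_restrict A v)); last first.
    by rewrite dualD dualZ.
  congr (dual_fun f _); apply: kothe_class_eq.
  have rE w := kothe_restrictE w mA.
  apply: filterS3 (filterI (rE (a *: u + v)) (kothe_linear a u v))
    (kothe_linear a (kothe_restrict A u) (kothe_restrict A v))
    (filterI (rE u) (rE v)) => t [-> ->] -> [-> ->].
  by case: ifP => // _; rewrite mulr0 addr0.
exists g; split => //; apply: dual_norm_leM => // u; by rewrite gE.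
Qed.

Definition kothe_le u v := \forall t \ae mu, kothe_class u t <= kothe_class v t.

Lemma kothe_leD u u' v v' : kothe_le u v -> kothe_le u' v' ->
  kothe_le (u + u') (v + v').
Proof.
move=> uv uv'; apply: filterS3 (filterI uv uv') (kothe_classD u u') (kothe_classD v v').
by move=> t [uvt uvt'] -> ->; exact: lerD.
Qed.

Lemma kothe_le_refl u : kothe_le u u.
Proof. exact: aeW. Qed.

(** The positive part of [v - w] is dominated by [|w_ n - w|] for large [n], so
    its norm is zero. *)
Lemma kothe_le_lim v (w_ : nat -> E) w N :
  (forall n, (N <= n)%N -> kothe_le v (w_ n)) ->
  w_ n @[n --> \oo] --> w -> kothe_le v w.
Proof.
move=> vw /cvgrPdist_lt wlim.
have [||p pE] := @exists_kothe (fun t => Num.max (kothe_class (v - w) t) 0) (v - w).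
- by apply: measurable_maxr; [exact: measurable_kothe_class|exact: measurable_cst].
- by apply: aeW => t; rewrite /Num.max; case: ifP => // _; rewrite normr0.
have p0 : p = 0.
  apply/eqP; rewrite -normr_le0; apply/ler_addgt0Pr => e e0; rewrite add0r.
  have [M _ hM] := wlim _ e0; set n := maxn M N.
  have wn : `|w - w_ n| < e by apply: hM => /=; exact: leq_maxl.
  apply: le_trans (ltW wn); rewrite distrC; apply: kothe_norm_le.
  apply: filterS3 (filterI pE (kothe_classB v w)) (kothe_classB (w_ n) w) (vw n (leq_maxr _ _)).
  move=> t [-> ->] -> vwn; rewrite ger0_norm ?le_max ?lexx ?orbT// ge_max normr_ge0 andbT.
  by apply: le_trans (ler_norm _); rewrite lerB.
apply: filterS3 pE (kothe_classB v w) (kothe_class0 E) => t + vwE zE.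
by rewrite p0 vwE zE -subr_le0 => ->; rewrite le_max lexx.
Qed.

(** Along a subsequence with [|u_ (s k)| <= 4^-k], the series of
    [2^k |u_ (s k)|] converges in [E], and its sum, finite almost everywhere,
    bounds every term. *)
Theorem kothe_cvg0_ae_subseq (u_ : nat -> E) : `|u_ n| @[n --> \oo] --> (0 : R) ->
  exists s, increasing_seq s /\
    \forall t \ae mu, kothe_class (u_ (s n)) t @[n --> \oo] --> (0 : R).
Proof.
move=> /cvgrPdist_lt u0.
have [|s [si sP]] := @exists_increasing (fun k n => `|u_ n| <= (4 ^- k : R)).
  move=> k N; have k0 : 0 < 4 ^- k :> R by rewrite invr_gt0 exprn_gt0.
  have [M _ hM] := u0 _ k0; exists (maxn M N); split; first exact: leq_maxr.
  have := hM (maxn M N) (leq_maxl _ _).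
  by rewrite /= sub0r normrN normr_id => /ltW.
have /choice[g gE] : forall k, exists v, \forall t \ae mu,
    kothe_class v t = 2 ^+ k * `|kothe_class (u_ (s k)) t|.
  move=> k; apply: (@exists_kothe _ (2 ^+ k *: u_ (s k))).
    apply: measurable_funM; first exact: measurable_cst.
    by apply: measurableT_comp => //; exact: measurable_kothe_class.
  apply: filterS (kothe_classZ (2 ^+ k) (u_ (s k))) => t ->.
  by rewrite !normrM normr_id.
have gnorm k : `|g k| <= 2 ^- k.
  apply: (@le_trans _ _ `|2 ^+ k *: u_ (s k)|).
    apply: kothe_norm_le; apply: filterS2 (gE k) (kothe_classZ (2 ^+ k) (u_ (s k))) => t -> ->.
    by rewrite !normrM normr_id.
  rewrite normrZ ger0_norm ?exprn_ge0//; apply: le_trans (ler_wpM2l _ (sP k)) _.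
    by rewrite exprn_ge0.
  rewrite (_ : 4 = 2 * 2) ?exprMn; last by rewrite -natrM.
  by rewrite invfM mulrA divff ?mul1r// expf_neq0.
have [H gH] : exists H : E, series g n @[n --> \oo] --> H.
  suff /normed_cvg/cvg_ex : cvgn [normed series g] by [].
  apply: (@series_le_cvg R (fun n => `|g n|) (geometric 1 (2^-1))) => [//|n|n|].
  - by rewrite geometric_ge0// invr_ge0.
  - by rewrite /= mul1r exprVn.
  - apply/cvg_ex; exists (1 * (1 - 2^-1)^-1); apply: cvg_geometric_series.
    by rewrite ger0_norm ?invr_ge0//; lra.
have g_ge0 k : kothe_le 0 (g k).
  apply: filterS2 (kothe_class0 E) (gE k) => t -> ->.
  by rewrite mulr_ge0// exprn_ge0.
have series_ge0 n : kothe_le 0 (series g n).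
  elim: n => [|n IH]; first by rewrite /series/= big_geq//; exact: kothe_le_refl.
  by have := kothe_leD IH (g_ge0 n); rewrite addr0 seriesSr.
have g_le_series k n : (k < n)%N -> kothe_le (g k) (series g n).
  elim: n => // n IH; rewrite seriesSr ltnS leq_eqVlt => /predU1P[->|/IH kn].
    by have := kothe_leD (series_ge0 n) (kothe_le_refl (g n)); rewrite add0r.
  by have := kothe_leD kn (g_ge0 n); rewrite addr0.
have g_le_H k : kothe_le (g k) H.
  by apply: kothe_le_lim gH => n; exact: g_le_series.
exists s; split => //.
apply: filterS2 (ae_foralln g_le_H) (ae_foralln gE) => t gHt gEt.
apply: norm_cvg0; apply: (@squeeze_seq _ (fun=> 0) _ (fun n => kothe_class H t * 2^-1 ^+ n)).
- move=> n; rewrite normr_ge0/= exprVn ler_pdivlMr ?exprn_gt0// mulrC.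
  by rewrite -gEt.
- exact: cvg_cst.
- rewrite -(mulr0 (kothe_class H t)); apply: cvgM; first exact: cvg_cst.
  by apply: cvg_expr; rewrite ger0_norm ?invr_ge0//; lra.
Qed.

(** Any ultrafilter weak limit of the restrictions to [A_ n] vanishes outside
    each [A_ m], so they tend weakly to 0; the norms of the restrictions to the
    complements then tend to [|u|], and the Kadets-Klee property applies. *)
Theorem kothe_restrict_cvg0 u (A_ : nat -> set T) :
  reflexive_space E -> kadets_klee E ->
  (forall n, measurable (A_ n)) -> {homo A_ : m n / (m <= n)%N >-> n `<=` m} ->
  (\forall t \ae mu, exists n, ~ A_ n t) ->
  `|kothe_restrict (A_ n) u| @[n --> \oo] --> (0 : R).
Proof.
move=> Erefl EKK mA Adecr A0; set x_ := fun n => kothe_restrict (A_ n) u.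
have x_le n : `|x_ n| <= `|u| by exact: kothe_restrict_norm_le.
have wx : weakly_cvg x_ 0.
  apply: (weak_cvg_of_ultra Erefl x_le) => U UU sU y yU.
  have y0 m : \forall t \ae mu, ~ A_ m t -> kothe_class y t = 0.
    have mC : measurable (~` A_ m) by exact: measurableC.
    have : kothe_restrict (~` A_ m) y = 0.
      apply: dual_separates => f; have [g [_ gE]] := exists_dual_restrict f mC.
      rewrite -gE; apply: (cvg_unique _ (yU g)) => //.
      apply: cvg_near_cst; apply: sU; exists m => // n /= mn; rewrite gE.
      rewrite (_ : kothe_restrict _ _ = 0) ?dual0//; apply: kothe_eq0.
      apply: filterS2 (kothe_restrictE (x_ n) mC) (kothe_restrictE u (mA n)) => t -> ->.
      case: ifPn => //; rewrite inE => nAm; case: ifPn => //; rewrite inE => An.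
      by exfalso; apply: nAm; exact: Adecr An.
    move=> r0; apply: filterS2 (kothe_restrictE y mC) (kothe_class0 E) => t.
    by rewrite r0 => yE zE nAm; rewrite zE mem_set in yE.
  apply: kothe_eq0; apply: filterS2 A0 (ae_foralln y0) => t [m nAm] h.
  exact: h nAm.
have wh : weakly_cvg (fun n => u - x_ n) u.
  move=> f; apply: (@cvg_eq_seq _ (fun n => f u - f (x_ n))) => [n|].
    by rewrite dualB.
  rewrite -[X in _ --> X]subr0 -(dual0 f); apply: cvgB; [exact: cvg_cst|exact: wx].
have h_le n : `|u - x_ n| <= `|u|.
  apply: kothe_norm_le.
  apply: filterS2 (kothe_classB u (x_ n)) (kothe_restrictE u (mA n)) => t -> ->.
  by case: ifP => _; rewrite ?subrr ?normr0 ?subr0.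
have nh : `|u - x_ n| @[n --> \oo] --> `|u|.
  have [u0|u0] := eqVneq u 0.
    apply: (@squeeze_seq _ (fun=> `|u|) _ (fun=> `|u|)) => [n||]; try exact: cvg_cst.
    by rewrite h_le u0 normr0 normr_ge0.
  have [f [f1 fu]] := exists_norming u u0.
  apply: (@squeeze_seq _ (fun n => f (u - x_ n)) _ (fun=> `|u|)) => [n||].
  - by rewrite h_le andbT; have := dual_le f (u - x_ n); rewrite f1 mul1r.
  - by rewrite -fu; exact: wh.
  - exact: cvg_cst.
apply: cvg_eq_seq (EKK _ _ wh nh) => n.
by rewrite addrAC subrr add0r normrN.
Qed.

(** Outside the set [A_ n] where some [h_ m] with [n <= m] exceeds [c u], [h_ n]
    is at most [c u]; these sets decrease to a null set, so [u] restricted to them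
    tends to 0. *)
Theorem kothe_dominated_cvg (h_ : nat -> E) u :
  reflexive_space E -> kadets_klee E ->
  (forall n, \forall t \ae mu, `|kothe_class (h_ n) t| <= kothe_class u t) ->
  (\forall t \ae mu, kothe_class (h_ n) t @[n --> \oo] --> (0 : R)) ->
  `|h_ n| @[n --> \oo] --> (0 : R).
Proof.
move=> Erefl EKK hu h0; apply/cvgrPdist_lt => e e0.
pose c := e / 2 / (`|u| + 1).
have u1 : 0 < `|u| + 1 by rewrite ltr_pwDr.
have c0 : 0 < c by rewrite !divr_gt0.
pose big m := [set t | c * kothe_class u t < `|kothe_class (h_ m) t|].
have mbig m : measurable (big m).
  apply: measurable_set_ltr.
    by apply: measurable_funM; [exact: measurable_cst|exact: measurable_kothe_class].
  by apply: measurableT_comp => //; exact: measurable_kothe_class.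
pose A_ n := \bigcup_(m in [set m | (n <= m)%N]) big m.
have mA n : measurable (A_ n) by apply: bigcup_measurable.
have Adecr : {homo A_ : m n / (m <= n)%N >-> n `<=` m}.
  by move=> m n mn t [k /= nk kt]; exists k => //=; exact: leq_trans nk.
have A0 : \forall t \ae mu, exists n, ~ A_ n t.
  apply: filterS2 h0 (ae_foralln hu) => t /cvgrPdist_lt ht0 hut.
  have : 0 <= kothe_class u t by exact: le_trans (normr_ge0 _) (hut 0%N).
  rewrite le_eqVlt => /predU1P[ut0|ut0].
    exists 0%N => -[m _ /=]; rewrite /big/= -ut0 mulr0 ltNge.
    by have := hut m; rewrite -ut0 => ->.
  have [N _ hN] := ht0 _ (mulr_gt0 c0 ut0); exists N => -[m /= Nm].
  rewrite /big/= ltNge => /negP; apply; have := hN m Nm.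
  by rewrite /= sub0r normrN => /ltW.
have e20 : 0 < e / 2 by rewrite divr_gt0.
have /cvgrPdist_lt/(_ _ e20)[N _ hN] := kothe_restrict_cvg0 u Erefl EKK mA Adecr A0.
exists N => // n /= Nn; rewrite sub0r normrN normr_id.
have := hN n Nn; rewrite /= sub0r normrN normr_id => rn.
apply: (@le_lt_trans _ _ `|c *: u + kothe_restrict (A_ n) u|).
  apply: kothe_norm_le.
  apply: filterS3 (kothe_linear c u (kothe_restrict (A_ n) u)) (kothe_restrictE u (mA n)) (hu n).
  move=> t -> -> hut; have ut0 := le_trans (normr_ge0 _) hut.
  have cu0 : 0 <= c * kothe_class u t by rewrite mulr_ge0// ltW.
  case: ifPn => [_|]; first by rewrite [leRHS]ger0_norm ?addr_ge0//; lra.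
  rewrite notin_setE => nA; rewrite addr0 [leRHS]ger0_norm// leNgt.
  by apply/negP => hb; apply: nA; exists n => //=.
apply: le_lt_trans (ler_normD _ _) _; rewrite normrZ gtr0_norm//.
suff : c * `|u| <= e / 2 by lra.
rewrite /c -mulrA ler_piMr ?(ltW e20)// mulrC ler_pdivrMr// mul1r lerDl.
exact: ler01.
Qed.

End kothe_lattice.

(** * Directional estimates in sluacs spaces *)

Section alternative_smoothness.
Context (R : realType).
Implicit Type X : normedModType R.

Lemma cvg_factor (u v : nat -> R) (a b : R) : a != 0 ->
  u n @[n --> \oo] --> a -> u n * v n @[n --> \oo] --> a * b ->
  v n @[n --> \oo] --> b.
Proof.
move=> a0 ua uvab; rewrite -(mulKf a0 b).
have near_eq : {near \oo, (fun n => (u n)^-1 * (u n * v n)) =1 v}.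
  have un0 : \forall n \near \oo, u n != 0 by apply: cvgr_neq0 ua _.
  by apply: filterS un0 => n un0; rewrite mulKf.
apply: cvg_trans (near_eq_cvg near_eq) _.
by apply: cvgM uvab; exact: cvgV.
Qed.

(** The direction of [y], with [z] as its value at [y = 0]: in this way
    [y = |y| normalize z y] holds for every [y]. *)
Definition normalize X (z y : X) : X := if y == 0 then z else `|y|^-1 *: y.

Lemma norm_normalize X (z y : X) : `|z| = 1 -> `|normalize z y| = 1.
Proof.
move=> z1; rewrite /normalize; case: eqVneq => // y0.
by rewrite normrZ normfV normr_id mulVf ?normr_eq0.
Qed.

Lemma normalizeK X (z y : X) : `|y| *: normalize z y = y.
Proof.
rewrite /normalize; case: eqVneq => [->|y0]; first by rewrite normr0 scale0r.
by rewrite scalerA divff ?normr_eq0// scale1r.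
Qed.

Lemma sluacs_plus_sluacs X : sluacs_plus X -> sluacs X.
Proof. by move=> sX x x_ f_ x1 xn1 f1 xx fx; apply/(sX x x_ f_ x1 xn1 f1 xx). Qed.

(** The functionals may have norm less than one: since they tend to 1 at unit
    vectors, their norms tend to 1, and they can be normalised. *)
Lemma sluacs_ball X (x : X) (x_ : nat -> X) (f_ : nat -> dual_space X) :
  sluacs X -> `|x| = 1 -> (forall n, `|x_ n| = 1) -> (forall n, `|f_ n| <= 1) ->
  `|x_ n + x| @[n --> \oo] --> (2 : R) ->
  f_ n (x_ n) @[n --> \oo] --> (1 : R) -> f_ n x @[n --> \oo] --> (1 : R).
Proof.
move=> sX x1 xn1 fn1 xx fx.
have x0 : x != 0 by rewrite -normr_eq0 x1 oner_eq0.
have [g [g1 _]] := exists_norming x x0.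
have fE n y : f_ n y = `|f_ n| * normalize g (f_ n) y.
  by rewrite -dual_funZ normalizeK.
have nf : `|f_ n| @[n --> \oo] --> (1 : R).
  apply: (@squeeze_seq _ (fun n => f_ n (x_ n)) _ (fun=> 1)) => // [n|]; last exact: cvg_cst.
  by rewrite fn1 andbT; have := dual_le (f_ n) (x_ n); rewrite xn1 mulr1.
have nx : normalize g (f_ n) x @[n --> \oo] --> (1 : R).
  apply: (sX x x_) => // [n|]; first exact: norm_normalize.
  apply: (cvg_factor (oner_neq0 R) nf); rewrite mulr1.
  by apply: cvg_eq_seq fx => n; rewrite -fE.
apply: (@cvg_eq_seq _ (fun n => `|f_ n| * normalize g (f_ n) x)) => [n|].
  by rewrite -fE.
by rewrite -[X in _ --> X]mulr1; exact: cvgM.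
Qed.

(** For a norming functional [f_ n] of [y_ n - tau_ n x], the quotient is at most
    [- f_ n x], and [f_ n] almost norms [y_ n]; hence [f_ n x] tends to [|x|]
    because [X] is sluacs. *)
Theorem sluacs_directional X (x : X) (y_ : nat -> X) (tau_ : nat -> R) (a : R) :
  sluacs X -> x != 0 -> 0 < a -> (forall n, 0 < tau_ n) ->
  tau_ n @[n --> \oo] --> (0 : R) -> `|y_ n| @[n --> \oo] --> a ->
  `|y_ n + x| @[n --> \oo] --> a + `|x| ->
  (tau_ n)^-1 * (`|y_ n - tau_ n *: x| - `|y_ n|) @[n --> \oo] --> - `|x|.
Proof.
move=> sX x0 a0 tau0 taulim ya yxa; pose x' := normalize x x.
have nx0 : `|x| != 0 by rewrite normr_eq0.
have x'1 : `|x'| = 1.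
  by rewrite /x' /normalize (negbTE x0) normrZ normfV normr_id mulVf.
have xE (f : dual_space X) : f x = `|x| * f x' by rewrite -dualZ normalizeK.
pose y' n := normalize x' (y_ n).
have y'1 n : `|y' n| = 1 by exact: norm_normalize.
have yE (f : dual_space X) n : f (y_ n) = `|y_ n| * f (y' n) by rewrite -dualZ normalizeK.
have y'lim (f : nat -> dual_space X) : f n (y_ n) @[n --> \oo] --> a ->
    f n (y' n) @[n --> \oo] --> (1 : R).
  move=> fa; apply: (cvg_factor (lt0r_neq0 a0) ya); rewrite mulr1.
  by apply: cvg_eq_seq fa => n; rewrite -yE.
have x'lim (f : nat -> dual_space X) : f n x @[n --> \oo] --> `|x| ->
    f n x' @[n --> \oo] --> (1 : R).
  move=> fa; apply: (cvg_factor nx0 (cvg_cst `|x|)); rewrite mulr1.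
  by apply: cvg_eq_seq fa => n; rewrite -xE.
have y'x' : `|y' n + x'| @[n --> \oo] --> (2 : R).
  have /choice[g gP] : forall n, exists g : dual_space X,
      `|g| = 1 /\ g (y_ n + x) = `|y_ n + x| by move=> n; exact: exists_norming x0.
  have g1 n : `|g n| = 1 by have [] := gP n.
  have gD n : g n (y_ n) + g n x = `|y_ n + x| by have [_ <-] := gP n; rewrite dualD.
  have gy n : g n (y_ n) <= `|y_ n| by have := dual_le (g n) (y_ n); rewrite g1 mul1r.
  have gx n : g n x <= `|x| by have := dual_le (g n) x; rewrite g1 mul1r.
  have gyx n : g n (y' n) + g n x' <= `|y' n + x'|.
    by rewrite -dualD; have := dual_le (g n) (y' n + x'); rewrite g1 mul1r.
  apply: (@squeeze_seq _ (fun n => g n (y' n) + g n x') _ (fun=> 2)) => [n||].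
  - rewrite gyx (le_trans (ler_normD _ _))// y'1 x'1; lra.
  - rewrite (_ : 2 = 1 + 1)//; apply: cvgD.
    + apply: y'lim; apply: (@squeeze_seq _ (fun n => `|y_ n + x| - `|x|) _
        (fun n => `|y_ n|)) => //.
        by move=> n; rewrite gy andbT -gD; have := gx n; lra.
      by rewrite -[X in _ --> X](addrK `|x|); apply: cvgB => //; exact: cvg_cst.
    + apply: x'lim; apply: (@squeeze_seq _ (fun n => `|y_ n + x| - `|y_ n|) _ (fun=> `|x|)).
      * by move=> n; rewrite gx andbT -gD; have := gy n; lra.
      * by rewrite -[X in _ --> X](addKr a) addrC; exact: cvgB.
      * exact: cvg_cst.
  - exact: cvg_cst.
have /choice[f fP] : forall n, exists f : dual_space X,
    `|f| = 1 /\ f (y_ n - tau_ n *: x) = `|y_ n - tau_ n *: x|.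
  by move=> n; exact: exists_norming x0.
have f1 n : `|f n| = 1 by have [] := fP n.
have fE n : `|y_ n - tau_ n *: x| = f n (y_ n) - tau_ n * f n x.
  by have [_ <-] := fP n; rewrite dualB dualZ.
have fy n : f n (y_ n) <= `|y_ n| by have := dual_le (f n) (y_ n); rewrite f1 mul1r.
have fx n : f n x <= `|x| by have := dual_le (f n) x; rewrite f1 mul1r.
have tri n : `|y_ n| - tau_ n * `|x| <= `|y_ n - tau_ n *: x|.
  by rewrite -[tau_ n](gtr0_norm (tau0 n)) -normrZ gtr0_norm// lerB_dist.
have tfx n : tau_ n * - `|x| <= tau_ n * f n x.
  by rewrite ler_pM2l//; have := dual_le (f n) (- x); rewrite f1 mul1r normrN dualN; lra.
have fya : f n (y_ n) @[n --> \oo] --> a.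
  apply: (@squeeze_seq _ (fun n => `|y_ n| - tau_ n * (2 * `|x|)) _ (fun n => `|y_ n|)) => //.
  - move=> n; rewrite fy andbT; have := tri n; have := tfx n; rewrite fE; lra.
  - rewrite -[X in _ --> X]subr0 -(mul0r (2 * `|x|)); apply: cvgB => //.
    by apply: cvgM => //; exact: cvg_cst.
have fx1 : f n x @[n --> \oo] --> `|x|.
  apply: (@cvg_eq_seq _ (fun n => `|x| * f n x')) => [n|]; first by rewrite -xE.
  rewrite -[X in _ --> X]mulr1; apply: cvgM; first exact: cvg_cst.
  exact: (sX _ y' _ x'1 y'1 f1 y'x' (y'lim _ fya)).
apply: (@squeeze_seq _ (fun=> - `|x|) _ (fun n => - f n x)) => [n||].
- rewrite ler_pdivlMl// ler_pdivrMl//; have := tri n; have := fy n.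
  by rewrite fE; lra.
- exact: cvg_cst.
- exact: cvgN.
Qed.

End alternative_smoothness.

(** * Functionals almost attaining their norm on a Koethe function space *)

Section kothe_functionals.
Context d (T : measurableType d) (R : realType) (mu : {measure set T -> \bar R}).
Context (E : kothe_function_space mu).
Implicit Types (u v w : E) (A : set T).

Lemma kothe_kadets_klee_cvg_subseq (e : E) (v_ : nat -> E) :
  reflexive_space E -> kadets_klee E -> kadets_klee (dual_space E) ->
  `|e| = 1 -> `|v_ n| @[n --> \oo] --> (1 : R) ->
  `|v_ n + e| @[n --> \oo] --> (2 : R) ->
  exists s v, [/\ increasing_seq s, v_ (s n) @[n --> \oo] --> v,
    \forall t \ae mu, kothe_class (v_ (s n)) t @[n --> \oo] --> kothe_class v t,
    `|v| = 1 & `|v + e| = 2].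
Proof.
move=> Erefl EKK EdKK e1 v1 ve2.
have [s [v [si sv]]] := kadets_klee_cvg_subseq Erefl EKK EdKK e1 v1 ve2.
have [t [ti tv]] := kothe_cvg0_ae_subseq sv.
have st := increasing_seq_comp si ti.
have vlim := cvg_subseq ti (cvg_of_dist sv).
exists (fun n => s (t n)), v; split => //.
- apply: filterS2 tv (ae_foralln (fun n => kothe_classB (v_ (s (t n))) v)) => x xlim xB.
  by apply/subr_cvg0; apply: cvg_eq_seq xlim => n; exact: xB.
- by apply: (cvg_unique _ (cvg_norm vlim)) => //; exact: (cvg_subseq st v1).
- apply: (cvg_unique _ (cvg_norm (cvgD vlim (cvg_cst e)))) => //.
  exact: (cvg_subseq st ve2).
Qed.

(** A functional keeps its value at [u] when it is cut off on the zero set of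
    [u]; the cut-off still tends to 1 at [v], which leaves nothing for the
    part of [v] on that zero set. *)
Lemma cvg0_restrict_zero_set u v (phi_ : nat -> dual_space E) :
  sluacs E -> `|u| = 1 -> `|v| = 1 -> `|u + v| = 2 ->
  (forall n, `|phi_ n| <= 1) -> phi_ n u @[n --> \oo] --> (1 : R) ->
  phi_ n (kothe_restrict [set t | kothe_class u t = 0] v) @[n --> \oo] --> (0 : R).
Proof.
move=> sE u1 v1 uv2 phi1 phiu; set A := [set t | _].
have mA : measurable A.
  rewrite (_ : A = kothe_class u @^-1` [set 0]); last by [].
  by rewrite -[X in measurable X]setTI; exact: (measurable_kothe_class u).
have mC : measurable (~` A) by exact: measurableC.
have uv : `|u + v| @[n --> \oo] --> (2 : R) by rewrite uv2; exact: cvg_cst.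
have /choice[g gP] := fun n => exists_dual_restrict (phi_ n) mC.
have gv : g n v @[n --> \oo] --> (1 : R).
  apply: (sluacs_ball (x_ := fun=> u) sE v1) => // [n|].
    by have [gn _] := gP n; exact: le_trans gn _.
  apply: cvg_eq_seq phiu => n; have [_ ->] := gP n; congr (dual_fun _ _).
  apply: kothe_class_eq; apply: filterS (kothe_restrictE u mC) => t ->.
  by case: ifPn => //; rewrite notin_setE => /contrapT.
have phiv : phi_ n v @[n --> \oo] --> (1 : R).
  exact: (sluacs_ball (x_ := fun=> u) sE v1).
apply: (@cvg_eq_seq _ (fun n => phi_ n v - g n v)) => [n|].
  have [_ ->] := gP n; rewrite -dualB; congr (dual_fun _ _).
  apply: kothe_class_eq; apply: filterS3 (kothe_restrictE v mA)
    (kothe_restrictE v mC) (kothe_classB v (kothe_restrict (~` A) v)) => t -> + ->.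
  by move=> ->; rewrite in_setC; case: (t \in A); rewrite /= ?subr0 ?subrr.
by rewrite -[X in _ --> X](subrr (1 : R)); exact: cvgB.
Qed.

(** With [h], also [c s - h] lies between 0 and [c s], so [phi] is at most [c |s|]
    there. If [phi] almost attains its norm at [s], the lower bound is close to 0. *)
Lemma dual_order_interval_ge (phi : dual_space E) (c : R) (s h : E) : 0 <= c ->
  `|phi| <= 1 -> (\forall t \ae mu, 0 <= kothe_class h t <= c * kothe_class s t) ->
  c * (phi s - `|s|) <= phi h.
Proof.
move=> c0 phi1 hs.
have : phi (c *: s - h) <= c * `|s|.
  apply: le_trans (dual_le _ _) _; apply: (@le_trans _ _ `|c *: s - h|).
    by rewrite ler_piMl.
  rewrite -[c in leRHS]ger0_norm// -normrZ; apply: kothe_norm_le.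
  apply: filterS3 hs (kothe_classB (c *: s) h) (kothe_classZ c s) => t /andP[h0 hs] -> ->.
  by rewrite !ger0_norm; lra.
by rewrite dualB dualZ mulrBr; lra.
Qed.

(** The truncations [min v (k w)] lie between 0 and [k w], hence the functionals
    tend to 0 at them, and they converge to the restriction of [v]. *)
Lemma cvg0_restrict_pos_set (s v w : E) (phi_ : nat -> dual_space E) :
  reflexive_space E -> kadets_klee E ->
  (forall n, `|phi_ n| <= 1) -> phi_ n s @[n --> \oo] --> `|s| ->
  phi_ n w @[n --> \oo] --> (0 : R) ->
  (\forall t \ae mu, 0 <= kothe_class v t <= kothe_class s t) ->
  (\forall t \ae mu, 0 <= kothe_class w t <= kothe_class s t) ->
  phi_ n (kothe_restrict [set t | 0 < kothe_class w t] v) @[n --> \oo] --> (0 : R).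
Proof.
move=> Erefl EKK phi1 phis phiw vs ws; set B := [set t | _].
have mB : measurable B.
  by apply: measurable_set_ltr; [exact: measurable_cst|exact: measurable_kothe_class].
set r := kothe_restrict B v.
have /choice[h hE] : forall k : nat, exists h : E, \forall t \ae mu,
    kothe_class h t = Num.min (kothe_class v t) (k%:R * kothe_class w t).
  move=> k; apply: (@exists_kothe _ _ _ _ _ _ v).
    apply: measurable_minr; first exact: measurable_kothe_class.
    by apply: measurable_funM; [exact: measurable_cst|exact: measurable_kothe_class].
  apply: filterS2 vs ws => t /andP[v0 _] /andP[w0 _].
  by rewrite !ger0_norm ?le_min ?v0 ?mulr_ge0// ge_min lexx.
have h0 k : phi_ n (h k) @[n --> \oo] --> (0 : R).
  apply: (@squeeze_seq _ (fun n => 1 * (phi_ n s - `|s|)) _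
    (fun n => k%:R * phi_ n w - k%:R * (phi_ n s - `|s|))) => [n||].
  - apply/andP; split.
      apply: dual_order_interval_ge => //; apply: filterS3 (hE k) vs ws => t ->.
      move=> /andP[v0 vst] /andP[w0 _].
      by rewrite mul1r le_min v0 mulr_ge0//= ge_min vst.
    rewrite lerBrDr -lerBrDl -dualZ -dualB; apply: dual_order_interval_ge => //.
    apply: filterS3 (filterI (hE k) (kothe_classZ k%:R w)) (kothe_classB (k%:R *: w) (h k))
      (filterI vs ws) => t [hEt ->] -> [/andP[v0 _] /andP[w0 wst]]; rewrite hEt.
    rewrite subr_ge0 ge_min lexx orbT/= lerBlDr.
    apply: (@le_trans _ _ (k%:R * kothe_class s t)); first exact: ler_wpM2l.
    by rewrite lerDl le_min v0 mulr_ge0.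
  - rewrite -[X in _ --> X](mulr0 1); apply: cvgM; first exact: cvg_cst.
    by rewrite -(subrr `|s|); apply: cvgB => //; exact: cvg_cst.
  - rewrite -[X in _ --> X]subr0; apply: cvgB.
      by rewrite -[X in _ --> X](mulr0 k%:R); apply: cvgM => //; exact: cvg_cst.
    rewrite -[X in _ --> X](mulr0 k%:R); apply: cvgM; first exact: cvg_cst.
    by rewrite -(subrr `|s|); apply: cvgB => //; exact: cvg_cst.
have hr : `|r - h k| @[k --> \oo] --> (0 : R).
  apply: (kothe_dominated_cvg (u := v) Erefl EKK) => [k|].
    apply: filterS3 (filterI (hE k) (kothe_classB r (h k)))
      (kothe_restrictE v mB) (filterI vs ws).
    move=> t [hEt ->] -> [/andP[v0 _] /andP[w0 wst]]; rewrite hEt.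
    have m0 : 0 <= Num.min (kothe_class v t) (k%:R * kothe_class w t).
      by rewrite le_min v0 mulr_ge0.
    have mv : Num.min (kothe_class v t) (k%:R * kothe_class w t) <= kothe_class v t.
      by rewrite ge_min lexx.
    by rewrite ler_norml; case: ifP => _; lra.
  apply: filterS3 (filterI (ae_foralln hE) (ae_foralln (fun k => kothe_classB r (h k))))
      (kothe_restrictE v mB) (filterI vs ws).
  move=> t [hEt rE] rB [/andP[v0 _] /andP[w0 _]].
  apply: cvg_near_cst; have [tB|tB] := boolP (t \in B).
    have wt : 0 < kothe_class w t by move: tB; rewrite inE.
    exists (Num.truncn (kothe_class v t / kothe_class w t)).+1 => // k /= kk.
    rewrite rE rB tB hEt min_l ?subrr// -ler_pdivrMr//.
    apply/ltW/(lt_le_trans (truncnS_gt _)); by rewrite ler_nat.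
  exists 0%N => // k _; rewrite /= rE rB (negbTE tB) hEt.
  have -> : kothe_class w t = 0.
    by apply/eqP; rewrite eq_le w0 andbT leNgt; move: tB; rewrite notin_setE => /negP.
  by rewrite mulr0 min_r// subrr.
apply: cvg0_uniform_approx => e e0; have /cvgrPdist_lt/(_ _ e0)[k _ hk] := hr.
exists (fun n => phi_ n (h k)); split => // n.
have := hk k (leqnn k); rewrite /= sub0r normrN normr_id => /ltW rk.
rewrite -[r](subrK (h k)) dualD (le_trans (ler_normD _ _))// [leLHS]addrC lerD2l.
apply: le_trans (norm_dual_le _ _) _; apply: le_trans rk.
by rewrite ler_piMl.
Qed.

End kothe_functionals.

(** * Koethe-Bochner spaces *)

Section kothe_bochner_sluacs.
Context d (T : measurableType d) (R : realType) (mu : {measure set T -> \bar R}).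
Context (E : kothe_function_space mu) (X : normedModType R).
Local Notation bochner := (kothe_bochner_fun E X).
Local Notation cls := (@kothe_bochner_class _ _ _ _ E X).

Lemma kothe_bochner_normE (f : bochner) (e : E) : norm_class f e -> `|cls f| = `|e|.
Proof. exact: kothe_bochner_norm_classE. Qed.

Lemma kothe_bochner_classZD (a : R) (f g : bochner) :
  cls (a *: f + g) = a *: cls f + cls g.
Proof.
rewrite kothe_bochner_classD -[_ *: _ in RHS]/(kothe_bochner_scale _ _).
by rewrite kothe_bochner_scale_class.
Qed.

Lemma exists_norm_class_ZD (a : R) (f g : bochner) :
  exists e : E, norm_class (fun t => a *: f t + g t) e /\ `|a *: cls f + cls g| = `|e|.
Proof.
have [e ee] := kothe_bochner_fun_norm_class (a *: f + g).
by exists e; split => //; rewrite -kothe_bochner_classZD; exact: kothe_bochner_normE.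
Qed.

(** Pointwise part of the proof: where [e0] is positive and [2 p0 = e0 + e], the
    values [f_ n t] and [f t] satisfy the hypotheses of [sluacs_directional]. *)
Lemma cvg0_directional_remainder (f : bochner) (f_ : nat -> bochner)
    (e : E) (e_ psi_ q_ b_ : nat -> E) (e0 p0 : E) (tau_ : nat -> R) (G : set T) :
  reflexive_space E -> kadets_klee E -> sluacs X ->
  norm_class f e -> (forall n, norm_class (f_ n) (e_ n)) ->
  (forall n, norm_class (fun t => 1 *: f_ n t + f t) (psi_ n)) ->
  (forall n, norm_class (fun t => - tau_ n *: f t + f_ n t) (q_ n)) ->
  (\forall t \ae mu, kothe_class (e_ n) t @[n --> \oo] --> kothe_class e0 t) ->
  (\forall t \ae mu, kothe_class (2^-1 *: psi_ n) t @[n --> \oo] --> kothe_class p0 t) ->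
  (forall n, 0 < tau_ n) -> tau_ n @[n --> \oo] --> (0 : R) ->
  (\forall t \ae mu, G t -> kothe_class e0 t != 0 /\
     2 * kothe_class p0 t = kothe_class e0 t + kothe_class e t) ->
  (forall n, \forall t \ae mu, kothe_class (b_ n) t =
    if t \in G then (tau_ n)^-1 * (kothe_class (q_ n) t - kothe_class (e_ n) t)
      + kothe_class e t else 0) ->
  `|b_ n| @[n --> \oo] --> (0 : R).
Proof.
move=> Erefl EKK sX ef ef_ psif qf elim plim tau0 taulim hG bE.
apply: (kothe_dominated_cvg (u := 2 *: e) Erefl EKK) => [n|].
  apply: filterS3 (filterI (bE n) (kothe_classZ 2 e)) (filterI ef (ef_ n)) (qf n).
  move=> t [-> ->] [-> ->] ->; have t0 := tau0 n.
  have h1 : `|- tau_ n *: f t + f_ n t| <= tau_ n * `|f t| + `|f_ n t|.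
    by rewrite (le_trans (ler_normD _ _))// normrZ normrN gtr0_norm.
  have h2 : `|f_ n t| - tau_ n * `|f t| <= `|- tau_ n *: f t + f_ n t|.
    rewrite [X in _ <= `|X|]addrC scaleNr; have := lerB_dist (f_ n t) (tau_ n *: f t).
    by rewrite normrZ gtr0_norm.
  case: ifP => _; last by rewrite normr0 mulr_ge0.
  set D := (tau_ n)^-1 * _.
  have D1 : D <= `|f t| by rewrite /D ler_pdivrMl//; lra.
  have D2 : - `|f t| <= D by rewrite /D ler_pdivlMl//; lra.
  by rewrite ler_norml; lra.
have psiZ n := kothe_classZ 2^-1 (psi_ n).
apply: filterS3 (filterI (filterI ef (ae_foralln ef_)) (filterI (ae_foralln psif) (ae_foralln qf)))
  (filterI (filterI elim plim) hG) (filterI (ae_foralln bE) (ae_foralln psiZ)).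
move=> t [[eft ef_t] [psift qft]] [[elimt plimt] hGt] [bEt psiZt].
have [tG|tG] := boolP (t \in G); last first.
  by apply: cvg_near_cst; exists 0%N => // n _; rewrite /= bEt (negbTE tG).
have [e0t p0t] := hGt (set_mem tG).
apply: (@cvg_eq_seq _ (fun n => (tau_ n)^-1 * (`|f_ n t - tau_ n *: f t| - `|f_ n t|) + `|f t|)).
  move=> n; rewrite bEt tG qft ef_t eft scaleNr addrC.
  by rewrite [in RHS]addrC [X in _ + _ * (`|X| - _)]addrC.
rewrite -[X in _ --> X](addNr `|f t|); apply: cvgD; last exact: cvg_cst.
have nlim : `|f_ n t| @[n --> \oo] --> kothe_class e0 t.
  by apply: cvg_eq_seq elimt => n; rewrite ef_t.
have [ft0|ft0] := eqVneq (f t) 0.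
  rewrite ft0 normr0 oppr0; apply: cvg_near_cst; exists 0%N => // n _ /=.
  by rewrite scaler0 subr0 subrr mulr0.
apply: (sluacs_directional (a := kothe_class e0 t)) => //.
  rewrite lt_neqAle eq_sym e0t /=.
  by apply: ler_cvg_to (cvg_cst 0) nlim _; exact: nearW.
rewrite -eft -p0t; apply: (@cvg_eq_seq _ (fun n => 2 * kothe_class (2^-1 *: psi_ n) t)).
  by move=> n; rewrite psiZt mulVKf// psift scale1r.
by apply: cvgM => //; exact: cvg_cst.
Qed.

(** The estimate of [F_ n (cls f)] from below, for sequences whose norm functions
    converge: [|f_ n(.) - tau_ n f(.)|] is bounded by [e_ n + tau_ n (c + b_ n)], where
    [b_ n] is the directional remainder. *)
Lemma sluacs_limit_step (f : bochner) (f_ : nat -> bochner)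
    (F_ : nat -> dual_space (kothe_bochner E X))
    (e : E) (e_ psi_ : nat -> E) (e0 p0 : E) :
  reflexive_space E -> kadets_klee E -> sluacs E -> sluacs X ->
  norm_class f e -> (forall n, norm_class (f_ n) (e_ n)) ->
  (forall n, norm_class (fun t => 1 *: f_ n t + f t) (psi_ n)) ->
  `|e| = 1 -> (forall n, `|e_ n| = 1) -> (forall n, `|F_ n| = 1) ->
  `|e_ n + e| @[n --> \oo] --> (2 : R) ->
  F_ n (cls (f_ n)) @[n --> \oo] --> (1 : R) ->
  e_ n @[n --> \oo] --> e0 ->
  (\forall t \ae mu, kothe_class (e_ n) t @[n --> \oo] --> kothe_class e0 t) ->
  `|e0| = 1 -> `|e0 + e| = 2 ->
  (\forall t \ae mu, kothe_class (2^-1 *: psi_ n) t @[n --> \oo] --> kothe_class p0 t) ->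
  `|p0| = 1 -> `|p0 + e| = 2 ->
  F_ n (cls f) @[n --> \oo] --> (1 : R).
Proof.
move=> Erefl EKK sE sX ef ef_ psif e1 en1 F1 ee2 Flim elim eae e01 e0e pae p01 p0e.
have e_neq0 : e != 0 by rewrite -normr_eq0 e1 oner_eq0.
have Ff1 n : F_ n (cls f) <= 1.
  by have := dual_le (F_ n) (cls f); rewrite F1 mul1r (kothe_bochner_normE ef) e1.
pose gam_ n := 1 - F_ n (cls (f_ n)).
have gam0 n : 0 <= gam_ n.
  have := dual_le (F_ n) (cls (f_ n)).
  by rewrite F1 mul1r (kothe_bochner_normE (ef_ n)) en1 /gam_; lra.
have gam0lim : gam_ n @[n --> \oo] --> (0 : R).
  by rewrite -[X in _ --> X](subrr 1); apply: cvgB => //; exact: cvg_cst.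
have gamlim : Num.sqrt (gam_ n) @[n --> \oo] --> (0 : R).
  rewrite -(sqrtr0 R).
  exact: (cvg_comp gam_ Num.sqrt gam0lim (@sqrt_continuous R 0)).
(* [tau_ n] tends to 0, but more slowly than the defect [gam_ n] *)
pose tau_ n := Num.sqrt (gam_ n) + n.+1%:R^-1.
have tau0 n : 0 < tau_ n by rewrite ltr_wpDl ?sqrtr_ge0// invr_gt0.
have taulim : tau_ n @[n --> \oo] --> (0 : R).
  by rewrite -[X in _ --> X]addr0; apply: cvgD => //; exact: cvg_harmonic.
have gamtau n : (tau_ n)^-1 * gam_ n <= Num.sqrt (gam_ n).
  rewrite ler_pdivrMl// -{1}(sqr_sqrtr (gam0 n)) expr2 ler_wpM2r ?sqrtr_ge0//.
  by rewrite lerDl invr_ge0.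
have /choice[q qP] : forall n, exists q : E,
    norm_class (fun t => - tau_ n *: f t + f_ n t) q /\
    `|- tau_ n *: cls f + cls (f_ n)| = `|q|.
  by move=> n; exact: exists_norm_class_ZD.
have qf n := (qP n).1.
pose w := e0 + e - 2 *: p0.
pose A := [set t | kothe_class e0 t = 0]; pose B := [set t | 0 < kothe_class w t].
have mA : measurable A.
  rewrite (_ : A = kothe_class e0 @^-1` [set 0]); last by [].
  by rewrite -[X in measurable X]setTI; exact: (measurable_kothe_class e0).
have mB : measurable B.
  by apply: measurable_set_ltr; [exact: measurable_cst|exact: measurable_kothe_class].
pose G := ~` (A `|` B).
have mG : measurable G by apply: measurableC; exact: measurableU.
have wE : \forall t \ae mu,
    kothe_class w t = kothe_class e0 t + kothe_class e t - 2 * kothe_class p0 t.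
  by apply: filterS3 (kothe_classB (e0 + e) (2 *: p0)) (kothe_classD e0 e) (kothe_classZ 2 p0)
    => t -> -> ->.
have psiZ n := kothe_classZ 2^-1 (psi_ n).
have bounds : \forall t \ae mu, [/\ 0 <= kothe_class e0 t, 0 <= kothe_class p0 t &
    2 * kothe_class p0 t <= kothe_class e0 t + kothe_class e t].
  apply: filterS3 (filterI eae pae) (filterI ef (ae_foralln ef_))
    (filterI (ae_foralln psif) (ae_foralln psiZ)).
  move=> t [et pt] [eft ef_t] [psift psiZt]; split.
  - by apply: ler_cvg_to (cvg_cst 0) et _; apply: nearW => n; rewrite ef_t.
  - apply: ler_cvg_to (cvg_cst 0) pt _; apply: nearW => n.
    by rewrite psiZt psift mulr_ge0// invr_ge0.
  - have pt2 : 2 * kothe_class (2^-1 *: psi_ n) t @[n --> \oo] --> 2 * kothe_class p0 t.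
      by apply: cvgM => //; exact: cvg_cst.
    have eet : kothe_class (e_ n) t + kothe_class e t @[n --> \oo] -->
        kothe_class e0 t + kothe_class e t by apply: cvgD => //; exact: cvg_cst.
    apply: ler_cvg_to pt2 eet _; apply: nearW => n; rewrite psiZt psift ef_t eft mulVKf//.
    by rewrite scale1r ler_normD.
pose rA := kothe_restrict A e; pose rB := kothe_restrict B e.
(* [c] is [- e] off [A] and [B], where the directional estimate holds, and at
   least [e] on them, where only the triangle inequality is available *)
pose c := 2 *: (rA + rB) - e.
have cE : \forall t \ae mu, kothe_class c t =
    2 * (kothe_class rA t + kothe_class rB t) - kothe_class e t.
  by apply: filterS3 (kothe_classB (2 *: (rA + rB)) e) (kothe_classD rA rB)
    (kothe_classZ 2 (rA + rB)) => t -> <- ->.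
have /choice[b bE] : forall n, exists b : E, \forall t \ae mu, kothe_class b t =
    if t \in G then (tau_ n)^-1 * (kothe_class (q n) t - kothe_class (e_ n) t)
      + kothe_class e t else 0.
  move=> n; exists (kothe_restrict G ((tau_ n)^-1 *: (q n - e_ n) + e)).
  apply: filterS3 (kothe_restrictE ((tau_ n)^-1 *: (q n - e_ n) + e) mG)
    (kothe_linear (tau_ n)^-1 (q n - e_ n) e)
    (kothe_classB (q n) (e_ n)) => t -> -> ->; by [].
have b0 : `|b n| @[n --> \oo] --> (0 : R).
  apply: (cvg0_directional_remainder (G := G) Erefl EKK sX ef ef_ psif qf eae pae tau0 taulim _ bE).
  apply: filterS2 wE bounds => t wEt [_ _ wt] Gt; split.
    by apply/eqP => At; apply: Gt; left.
  apply/eqP; rewrite eq_le wt /= -subr_le0 -wEt leNgt.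
  by apply/negP => Bt; apply: Gt; right.
have q_le n : `|q n| <= `|e_ n + tau_ n *: c| + tau_ n * `|b n|.
  apply: (@le_trans _ _ `|tau_ n *: b n + (e_ n + tau_ n *: c)|); last first.
    by rewrite addrC (le_trans (ler_normD _ _))// normrZ gtr0_norm.
  apply: kothe_norm_le.
  apply: filterS3 (filterI (filterI (kothe_linear (tau_ n) (b n) (e_ n + tau_ n *: c))
    (kothe_classD (e_ n) (tau_ n *: c))) (filterI (kothe_classZ (tau_ n) c) cE))
    (filterI (filterI (kothe_restrictE e mA) (kothe_restrictE e mB)) (bE n))
    (filterI (filterI ef (ef_ n)) (qf n)).
  move=> t [[-> ->] [-> ->]] [[-> ->] ->] [[-> ->] ->].
  have t0 := tau0 n; set Q := - tau_ n *: f t + f_ n t.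
  have Q0 : 0 <= `|Q| by [].
  have Qle : `|Q| <= tau_ n * `|f t| + `|f_ n t|.
    by rewrite (le_trans (ler_normD _ _))// normrZ normrN gtr0_norm.
  have ft0 : 0 <= tau_ n * `|f t| by rewrite mulr_ge0// ltW.
  rewrite normr_id (le_trans _ (ler_norm _))//.
  have [tA|tA] := boolP (t \in A); have [tB|tB] := boolP (t \in B);
    rewrite /G in_setC in_setU ?tA ?tB ?(negbTE tA) ?(negbTE tB) /= ?mulr0 ?add0r; try lra.
  have : tau_ n * ((tau_ n)^-1 * (`|Q| - `|f_ n t|)) = `|Q| - `|f_ n t|.
    by rewrite mulVKf// gt_eqF.
  by set D := (tau_ n)^-1 * _; lra.
have /choice[phi phiP] : forall n, exists phi : dual_space E,
    `|phi| = 1 /\ phi (e_ n + tau_ n *: c) = `|e_ n + tau_ n *: c|.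
  by move=> n; exact: exists_norming e_neq0.
have phi1 n : `|phi n| = 1 by have [] := phiP n.
have phi_le1 n : `|phi n| <= 1 by rewrite phi1.
have phiD n : phi n (e_ n) + tau_ n * phi n c = `|e_ n + tau_ n *: c|.
  by have [_ <-] := phiP n; rewrite (dualD _ (e_ n)) (dualZ _ (tau_ n)).
have phi_en n : phi n (e_ n) <= 1.
  by have := dual_le (phi n) (e_ n); rewrite phi1 mul1r en1.
have phi_e n : phi n e <= 1 by have := dual_le (phi n) e; rewrite phi1 mul1r e1.
have phien_lim : phi n (e_ n) @[n --> \oo] --> (1 : R).
  apply: (@squeeze_seq _ (fun n => 1 - tau_ n * (2 * `|c|)) _ (fun=> 1)) => [n||].
  - rewrite phi_en andbT.
    have := lerB_normD (e_ n) (tau_ n *: c); rewrite en1 normrZ gtr0_norm// -phiD.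
    have : tau_ n * phi n c <= tau_ n * `|c|.
      by rewrite ler_pM2l//; have := dual_le (phi n) c; rewrite phi1 mul1r.
    lra.
  - rewrite -[X in _ --> X]subr0 -(mul0r (2 * `|c|)); apply: cvgB; first exact: cvg_cst.
    by apply: cvgM => //; exact: cvg_cst.
  - exact: cvg_cst.
have phie_lim : phi n e @[n --> \oo] --> (1 : R) by exact: (sluacs_ball (x_ := e_)).
have phie0_lim : phi n e0 @[n --> \oo] --> (1 : R).
  apply: (@cvg_eq_seq _ (fun n => phi n (e_ n) - phi n (e_ n - e0))) => [n|].
    by rewrite dualB opprB addrC subrK.
  rewrite -[X in _ --> X]subr0; apply: cvgB => //; apply: norm_cvg0.
  apply: (@squeeze_seq _ (fun=> 0) _ (fun n => `|e_ n - e0|)) => [n||].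
  - by rewrite normr_ge0 /=; have := norm_dual_le (phi n) (e_ n - e0); rewrite phi1 mul1r.
  - exact: cvg_cst.
  - by rewrite -(@normr0 _ E); apply: cvg_norm; apply/subr_cvg0.
have ep0_lim : `|e + p0| @[n --> \oo] --> (2 : R) by rewrite addrC p0e; exact: cvg_cst.
have phip0_lim : phi n p0 @[n --> \oo] --> (1 : R).
  exact: (sluacs_ball (x_ := fun=> e) sE p01).
have phirA : phi n rA @[n --> \oo] --> (0 : R).
  exact: (cvg0_restrict_zero_set sE e01 e1 e0e).
have phirB : phi n rB @[n --> \oo] --> (0 : R).
  apply: (cvg0_restrict_pos_set (s := e0 + e) Erefl EKK phi_le1).
  - rewrite e0e (_ : 2 = 1 + 1)//.
    by apply: (@cvg_eq_seq _ (fun n => phi n e0 + phi n e)) => [n|]; [rewrite dualD|exact: cvgD].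
  - apply: (@cvg_eq_seq _ (fun n => phi n e0 + phi n e - 2 * phi n p0)) => [n|].
      by rewrite dualB dualD dualZ.
    rewrite (_ : 0 = 1 + 1 - 2 * 1); last lra.
    by apply: cvgB; [exact: cvgD|apply: cvgM => //; exact: cvg_cst].
  - apply: filterS3 bounds (kothe_classD e0 e) ef => t [? _ _] -> ->.
    by rewrite normr_ge0 lerDr.
  - apply: filterS3 bounds (kothe_classD e0 e) wE => t [? ? ?] -> ->; lra.
have Ff_ge n : phi n e - 2 * (phi n rA + phi n rB) - `|b n| - Num.sqrt (gam_ n) <= F_ n (cls f).
  have Fq : F_ n (- tau_ n *: cls f + cls (f_ n)) <= `|q n|.
    by rewrite -(qP n).2; have := dual_le (F_ n) (- tau_ n *: cls f + cls (f_ n)); rewrite F1 mul1r.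
  have cphi : phi n c = 2 * (phi n rA + phi n rB) - phi n e by rewrite dualB dualZ dualD.
  have t0 := tau0 n.
  have gt : gam_ n <= tau_ n * Num.sqrt (gam_ n) by rewrite -ler_pdivrMl.
  have := q_le n; rewrite -phiD cphi; move: Fq; rewrite dualD dualZ.
  have -> : F_ n (cls (f_ n)) = 1 - gam_ n by rewrite /gam_; lra.
  have := phi_en n => h1 h2 h3; rewrite -(ler_pM2l t0); lra.
apply: (@squeeze_seq _ (fun n => phi n e - 2 * (phi n rA + phi n rB) - `|b n| - Num.sqrt (gam_ n))
  _ (fun=> 1)) => [n||].
- by rewrite Ff_ge Ff1.
- have restr_lim : 2 * (phi n rA + phi n rB) @[n --> \oo] --> 2 * (0 + 0 : R).
    by apply: cvgM; [exact: cvg_cst|exact: cvgD].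
  rewrite addr0 mulr0 in restr_lim.
  have lim1 : phi n e - 2 * (phi n rA + phi n rB) @[n --> \oo] --> (1 : R).
    by rewrite -[X in _ --> X]subr0; exact: cvgB.
  have lim2 : phi n e - 2 * (phi n rA + phi n rB) - `|b n| @[n --> \oo] --> (1 : R).
    by rewrite -[X in _ --> X]subr0; exact: cvgB.
  by rewrite -[X in _ --> X]subr0; exact: cvgB.
- exact: cvg_cst.
Qed.

End kothe_bochner_sluacs.

(** Reduction of the theorem to [sluacs_limit_step] by passing to subsequences:
    [v n + e] has norm close to 2 because [(x_ n + x) / 2 + x] is the difference
    of [3 / 2 (x_ n + x)] and [x_ n]. *)
Theorem theorem3p10 (R : realType) (d : measure_display) (T : measurableType d)
    (mu : {measure set T -> \bar R}) (E : kothe_function_space mu)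
    (X : completeNormedModType R) :
  measure_is_complete mu -> sigma_finite [set: T] mu ->
  sluacs_plus E -> reflexive_space E ->
  kadets_klee E -> kadets_klee (dual_space E) ->
  sluacs X -> sluacs (kothe_bochner E X).
Proof.
move=> _ _ sEp Erefl EKK EdKK sX x x_ F_ x1 xn1 F1 xx2 Fx.
have sE := sluacs_plus_sluacs sEp.
pose f := repr x; pose f_ n := repr (x_ n).
have fE : kothe_bochner_class f = x by exact: kothe_bochner_class_repr.
have f_E n : kothe_bochner_class (f_ n) = x_ n by exact: kothe_bochner_class_repr.
have [e ef] := kothe_bochner_fun_norm_class f.
have /choice[e_ ef_] := fun n => kothe_bochner_fun_norm_class (f_ n).
have /choice[psi psiP] := fun n => exists_norm_class_ZD 1 (f_ n) f.
have psif n := (psiP n).1.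
have psi_norm n : `|psi n| = `|x_ n + x| by have [_ <-] := psiP n; rewrite scale1r fE f_E.
have e1 : `|e| = 1 by rewrite -(kothe_bochner_normE ef) fE.
have en1 n : `|e_ n| = 1 by rewrite -(kothe_bochner_normE (ef_ n)) f_E.
have ee2 : `|e_ n + e| @[n --> \oo] --> (2 : R).
  apply: (@squeeze_seq _ (fun n => `|x_ n + x|) _ (fun=> 2)) => // [n|]; last exact: cvg_cst.
  apply/andP; split; last by rewrite (le_trans (ler_normD _ _))// en1 e1; lra.
  rewrite -psi_norm; apply: kothe_norm_le.
  apply: filterS3 (psif n) (filterI (ef_ n) ef) (kothe_classD (e_ n) e) => t -> [-> ->] ->.
  by rewrite normr_id scale1r (le_trans (ler_normD _ _))// ler_norm.
pose v n := 2^-1 *: psi n.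
have v_norm n : `|v n| = 2^-1 * `|x_ n + x|.
  by rewrite normrZ ger0_norm ?invr_ge0// psi_norm.
have v1 : `|v n| @[n --> \oo] --> (1 : R).
  apply: (@cvg_eq_seq _ (fun n => 2^-1 * `|x_ n + x|)) => [n|]; first by rewrite v_norm.
  rewrite [X in _ --> X](_ : 1 = 2^-1 * 2); last lra.
  by apply: cvgM => //; exact: cvg_cst.
have ve2 : `|v n + e| @[n --> \oo] --> (2 : R).
  apply: (@squeeze_seq _ (fun n => 3 / 2 * `|x_ n + x| - 1) _ (fun n => `|v n| + 1)) => [n||].
  - apply/andP; split; last by rewrite (le_trans (ler_normD _ _))// e1.
    have [r [rE rn]] := exists_norm_class_ZD 2^-1 (1 *: f_ n + f) f.
    apply: (@le_trans _ _ `|r|).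
      rewrite -rn kothe_bochner_classZD scale1r fE f_E.
      have := lerB_dist ((3 / 2) *: (x_ n + x)) (x_ n).
      rewrite xn1 normrZ ger0_norm; last lra.
      move=> /le_trans; apply; rewrite le_eqVlt; apply/orP; left; apply/eqP; congr (`|_|).
      have -> : 3 / 2 = 2^-1 + 1 :> R by lra.
      by rewrite scalerDl scale1r -addrA; congr (_ + _); rewrite addrAC subrr add0r.
    apply: kothe_norm_le; apply: filterS3 (filterI rE ef)
      (kothe_linear 2^-1 (psi n) e) (psif n) => t [rt et] -> pt.
    rewrite rt et pt normr_id (le_trans (ler_normD _ _))// normrZ ger0_norm ?invr_ge0//.
    exact: ler_norm.
  - rewrite [X in _ --> X](_ : 2 = 3 / 2 * 2 - 1); last lra.
    by apply: cvgB; [apply: cvgM => //|]; exact: cvg_cst.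
  - by rewrite (_ : 2 = 1 + 1)//; apply: cvgD => //; exact: cvg_cst.
apply: cvg_of_subseq => s si.
have es1 : `|e_ (s n)| @[n --> \oo] --> (1 : R).
  by apply: (@cvg_eq_seq R (fun=> 1)) => [n|]; [rewrite en1|exact: cvg_cst].
have [s1 [e0 [s1i elim eae e01 e0e]]] := kothe_kadets_klee_cvg_subseq
  Erefl EKK EdKK e1 es1 (cvg_subseq si ee2).
have ss1 := increasing_seq_comp si s1i.
have [s2 [p0 [s2i _ pae p01 p0e]]] := kothe_kadets_klee_cvg_subseq
  Erefl EKK EdKK e1 (cvg_subseq ss1 v1) (cvg_subseq ss1 ve2).
have st := increasing_seq_comp ss1 s2i.
exists (fun n => s1 (s2 n)); split; first exact: increasing_seq_comp.
rewrite -fE.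
apply: (sluacs_limit_step (f_ := fun n => f_ (s (s1 (s2 n))))
  (e_ := fun n => e_ (s (s1 (s2 n)))) (psi_ := fun n => psi (s (s1 (s2 n)))) (e0 := e0) (p0 := p0)
  Erefl EKK sE sX ef) => //.
- exact: (cvg_subseq st ee2).
- apply: (@cvg_eq_seq _ (fun n => F_ (s (s1 (s2 n))) (x_ (s (s1 (s2 n)))))) => [n|].
    by rewrite f_E.
  exact: (cvg_subseq st Fx).
- exact: (cvg_subseq s2i elim).
- by apply: filterS eae => t; exact: cvg_subseq.
Qed.
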